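(* Let $(T,\sigma)$ be a completely contractive covariant representation of the $W^*$-correspondence $E$ over the von Neumann algebra $M$ with the property that $\|\tilde T\|<1$, and let $(V,\pi)$ be its minimal isometric dilation. Then $(V,\pi)$ is an induced representation.
   Context: Conventions: Hilbert space and module-valued inner products are linear in the second variable; representations and left actions are unital. A $W^{*}$-correspondence $E$ over a von Neumann algebra $M$ is a self-dual right Hilbert $C^*$-module over $M$ with a normal $*$-homomorphism $\varphi:M\to\mathcal{L}(E)$, where $\mathcal{L}(E)$ is the $W^*$-algebra of bounded (adjointable) module maps on $E$. Internal tensor powers $E^{\otimes n}$ (balanced over $M$, $E^{\otimes0}=M$) are $W^*$-correspondences, and so is the Fock space $\mathcal{F}(E)=M\oplus E\oplus E^{\otimes2}\oplus\cdots$ with left action $\varphi_\infty(a)=\mathrm{diag}(a,\varphi(a),\varphi^{(2)}(a),\dots)$, $\varphi^{(n)}(a)(\xi_1\otimes\cdots\otimes\xi_n)=(\varphi(a)\xi_1)\otimes\xi_2\otimes\cdots\otimes\xi_n$. For $\xi\in E$, $T_\xi\eta=\xi\otimes\eta$ on $\mathcal{F}(E)$. $E\otimes_\sigma H$ is the Hausdorff completion of the algebraic tensor product in $\langle\xi\otimes h,\eta\otimes k\rangle=\langle h,\sigma(\langle\xi,\eta\rangle)k\rangle$ (similarly for $\mathcal{F}(E)$). A completely contractive covariant representation of $E$ on $H$ is a pair $(T,\sigma)$: $\sigma$ a normal $*$-representation of $M$ on $H$, and $T:E\to B(H)$ a linear completely contractive map ($E$ carrying the operator space structure of its linking algebra)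 with $T(a\xi b)=\sigma(a)T(\xi)\sigma(b)$, continuous from the $\sigma$-topology of $E$ (generated by the functionals $\sum_n\omega_n(\langle\eta_n,\cdot\rangle)$, $\omega_n\in M_*$, $\eta_n\in E$, $\sum\|\omega_n\|\|\eta_n\|<\infty$) to the ultraweak topology. Equivalently, $\tilde T:E\otimes_\sigma H\to H$, $\tilde T(\xi\otimes h)=T(\xi)h$, is a well-defined contraction with $\tilde T(\varphi(a)\otimes I_H)=\sigma(a)\tilde T$. It is isometric if $T(\xi)^*T(\eta)=\sigma(\langle\xi,\eta\rangle)$ for all $\xi,\eta$ (equivalently, $\tilde T$ is an isometry). A minimal isometric dilation of $(T,\sigma)$ is an isometric covariant representation $(V,\pi)$ of $E$ on a Hilbert space $K\supseteq H$ such that, with $P$ the projection of $K$ onto $H$: $P$ commutes with $\pi(M)$ and $\pi(a)P=\sigma(a)P$; each $V(\xi)^*$ leaves $H$ invariant and $PV(\xi)P=T(\xi)P$; and the smallest subspace of $K$ containing $H$ and reducing $(V,\pi)$ is $K$. It exists and is unique up to unitary equivalence. If $\pi_0$ is a normal representation of $M$ on $H_0$, the covariant representation of $E$ on $\mathcal{F}(E)\otimes_{\pi_0}H_0$ induced by $\pi_0$ is $\xi\mapsto T_\xi\otimes I_{H_0}$, $a\mapsto\varphi_\infty(a)\otimes I_{H_0}$. A covariant representation is called induced if it is unitarily equivalent to one of this form. *)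

(* Defs.v *)
From HB Require Import structures.
From mathcomp Require Import all_boot all_order all_algebra.
From mathcomp Require Import complex.
From mathcomp Require Import all_classical all_reals all_analysis.

Set Implicit Arguments.
Unset Strict Implicit.
Unset Printing Implicit Defensive.

Import Order.TTheory GRing.Theory Num.Theory numFieldNormedType.Exports.
Local Open Scope classical_set_scope.
Local Open Scope ring_scope.

(* The norm of a normedModType over R[i] takes its values in R[i]; nrm is the
   same number, seen in R. *)
Definition nrm (R : realType) (V : normedZmodType R[i]) (x : V) : R :=
  complex.Re `|x|.

(* Complex Hilbert spaces; the inner product is linear in the second variable. *)
Structure hilbert (R : realType) := Hilbert {
  hspace :> completeNormedModType R[i];
  dot : hspace -> hspace -> R[i];
  dot_linear : forall x, linear_for *%R (dot x);
  dot_conj : forall x y, dot y x = Num.conj (dot x y);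
  dot_norm : forall x, dot x x = `|x| ^+ 2 }.
Arguments dot {R h}.

Section Operators.
Variable R : realType.
Implicit Types H K : hilbert R.

Definition bounded_op H K : set (H -> K) :=
  [set A | linear A /\ exists c : R, forall x, nrm (A x) <= c * nrm x].

(* The Hilbert space adjoint; it is a default map if there is no adjoint. *)
Definition adj H K (A : H -> K) : K -> H :=
  xget (fun=> 0) [set B : K -> H | forall x y, dot (B y) x = dot y (A x)].

Definition opnorm H K (A : H -> K) : R :=
  sup [set nrm (A x) | x in [set x : H | nrm x <= 1]].

(* The norm of an n x n matrix of operators, acting on the direct sum of n
   copies of H. *)
Definition opmx_norm n H K (A : 'I_n -> 'I_n -> H -> K) : R :=
  sup [set Num.sqrt (\sum_i nrm (\sum_j A i j (x j)) ^+ 2) |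
        x in [set x : 'I_n -> H | \sum_j nrm (x j) ^+ 2 <= 1]].

Definition commutant H (S : set (H -> H)) : set (H -> H) :=
  [set b | bounded_op b /\ forall a, S a -> a \o b = b \o a].

(* The ultraweakly continuous functionals on a set D of bounded operators;
   only the values on D of a functional are relevant. *)
Definition predual H (D : set (H -> H)) : set ((H -> H) -> R[i]) :=
  [set w | exists x y : nat -> H,
    [/\ cvgn (series (fun n => nrm (x n) ^+ 2)),
        cvgn (series (fun n => nrm (y n) ^+ 2)) &
        forall a, D a ->
          series (fun n => dot (x n) (a (y n)) : R[i]^o) @ \oo
            --> (w a : R[i]^o)]].

(* Continuity on D of f, for the weak topologies generated by the sets of
   functionals A (on the source) and B (on the target). *)
Definition weak_continuous (X Y : Type) (D : set X)
    (A : set (X -> R[i])) (B : set (Y -> R[i])) (f : X -> Y) : Prop :=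
  forall b, B b -> forall x, D x -> forall e : R, 0 < e ->
  exists n (w : 'I_n -> X -> R[i]) (d : R),
    [/\ forall i, A (w i), 0 < d &
        forall y, D y -> (forall i, nrm (w i y - w i x) < d) ->
          nrm (b (f y) - b (f x)) < e].

(* Density of S in the weak topology generated by the set of functionals A. *)
Definition weak_dense (X : Type) (A : set (X -> R[i])) (S : set X) : Prop :=
  forall x (e : R), 0 < e -> forall n (w : 'I_n -> X -> R[i]),
    (forall i, A (w i)) ->
    exists2 y, S y & forall i, nrm (w i y - w i x) < e.

(* The linear span of the elementary tensors t x y, for a bilinear map t. *)
Definition tensor_span (X Y : Type) (Z : nmodType) (t : X -> Y -> Z) : set Z :=
  [set z | exists n (x : 'I_n -> X) (y : 'I_n -> Y), z = \sum_i t (x i) (y i)].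

(* A von Neumann algebra, given as acting on a Hilbert space. The module
   structures below are given by functions defined on all maps
   vn_space -> vn_space, of which only the values on the algebra matter. *)
Structure vnalg := VNAlg {
  vn_space : hilbert R;
  vn_op :> (vn_space -> vn_space) -> Prop;
  vn_bounded : forall a, vn_op a -> bounded_op a;
  vn_adj : forall a, vn_op a -> vn_op (adj a);
  vn_bicommutant : (vn_op : set _) = commutant (commutant vn_op) }.

End Operators.

Notation vn_map M := (vn_space M -> vn_space M).

Section Modules.
Variables (R : realType) (M : vnalg R).

Definition fun_norm (w : vn_map M -> R[i]) : R :=
  sup [set nrm (w a) | a in [set a | M a /\ opnorm a <= 1]].

Structure hmod := HMod {
  hm_space :> completeNormedModType R[i];
  ract : hm_space -> vn_map M -> hm_space;
  ip : hm_space -> hm_space -> vn_map M;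
  ract_linearl : forall a, M a -> linear (ract^~ a);
  ract_linearr : forall x a b (c : R[i]), M a -> M b ->
    ract x (c *: a + b) = c *: ract x a + ract x b;
  ract_comp : forall x a b, M a -> M b -> ract x (a \o b) = ract (ract x a) b;
  ract_id : forall x, ract x id = x;
  ip_in : forall x y, M (ip x y);
  ip_linear : forall x, linear (ip x);
  ip_ract : forall x y a, M a -> ip x (ract y a) = ip x y \o a;
  ip_adj : forall x y, ip y x = adj (ip x y);
  ip_ge0 : forall x h, 0 <= dot h (ip x x h);
  ip_norm : forall x, nrm x ^+ 2 = opnorm (ip x x) }.

Definition self_dual (E : hmod) : Prop :=
  forall f : E -> vn_map M,
    (forall x, M (f x)) -> linear f ->
    (forall x a, M a -> f (ract x a) = f x \o a) ->
    (exists c : R, forall x, opnorm (f x) <= c * nrm x) ->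
  exists y, forall x, f x = ip y x.

Definition adjointable (E : hmod) : set (E -> E) :=
  [set A | [/\ linear A, exists c : R, forall x, nrm (A x) <= c * nrm x,
    forall x a, M a -> A (ract x a) = ract (A x) a &
    exists B : E -> E, forall x y, ip (A x) y = ip x (B y)]].

(* The functionals generating the sigma-topology of E. *)
Definition sigma_fun (E : hmod) : set (E -> R[i]) :=
  [set f | exists (w : nat -> vn_map M -> R[i]) (y : nat -> E),
    [/\ forall n, predual (M : set _) (w n),
        cvgn (series (fun n => fun_norm (w n) * nrm (y n))) &
        forall x, series (fun n => w n (ip (y n) x) : R[i]^o) @ \oo
                    --> (f x : R[i]^o)]].

(* The predual of the W*-algebra L(E), for E self-dual. *)
Definition adjointable_predual (E : hmod) : set ((E -> E) -> R[i]) :=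
  [set f | exists (w : nat -> vn_map M -> R[i]) (x y : nat -> E),
    [/\ forall n, predual (M : set _) (w n),
        cvgn (series (fun n => fun_norm (w n) * nrm (x n) * nrm (y n))) &
        forall A, adjointable A ->
          series (fun n => w n (ip (x n) (A (y n))) : R[i]^o) @ \oo
            --> (f A : R[i]^o)]].

Structure wcorr := WCorr {
  wc_mod :> hmod;
  lact : vn_map M -> wc_mod -> wc_mod;
  wc_self_dual : self_dual wc_mod;
  lact_in : forall a, M a -> adjointable (lact a);
  lact_linear : forall a b (c : R[i]), M a -> M b ->
    lact (c *: a + b) = c *: lact a + lact b;
  lact_comp : forall a b, M a -> M b -> lact (a \o b) = lact a \o lact b;
  lact_id : lact id = id;
  lact_adj : forall a, M a -> forall x y, ip (lact a x) y = ip x (lact (adj a) y);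
  lact_normal : weak_continuous (M : set _) (predual (M : set _))
                  (@adjointable_predual wc_mod) lact }.

(* G is the internal tensor product of E1 and E2, balanced over M, in the
   category of W*-correspondences (the self-dual extension of the algebraic
   one, in which the elementary tensors span a sigma-dense subspace), with
   elementary tensors t x y. *)
Record is_tensor (E1 E2 G : wcorr) (t : E1 -> E2 -> G) : Prop := IsTensor {
  tensor_linearl : forall y, linear (t^~ y);
  tensor_linearr : forall x, linear (t x);
  tensor_balanced : forall x y a, M a -> t (ract x a) y = t x (lact a y);
  tensor_ract : forall x y a, M a -> ract (t x y) a = t x (ract y a);
  tensor_lact : forall x y a, M a -> lact a (t x y) = t (lact a x) y;
  tensor_ip : forall x1 y1 x2 y2,
    ip (t x1 y1) (t x2 y2) = ip y1 (lact (ip x1 x2) y2);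
  tensor_dense : weak_dense (@sigma_fun G) (tensor_span t) }.

(* The tensor powers and the Fock space of E, which are determined up to
   isomorphism by these conditions. The elements of the Fock space are given by
   their coordinates: it consists of all the sequences s in the product of the
   tensor powers for which the sum of the ip (s n) (s n) has bounded partial
   sums, and its inner product is the ultraweakly convergent sum of those of
   the coordinates. *)
Structure fock (E : wcorr) := Fock {
  pow : nat -> wcorr;
  pow0 : vn_map M -> pow 0;
  pow0_linear : forall a b (c : R[i]), M a -> M b ->
    pow0 (c *: a + b) = c *: pow0 a + pow0 b;
  pow0_surj : forall x, exists2 a, M a & x = pow0 a;
  pow0_ip : forall a b, M a -> M b -> ip (pow0 a) (pow0 b) = adj a \o b;
  pow0_ract : forall a b, M a -> M b -> ract (pow0 a) b = pow0 (a \o b);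
  pow0_lact : forall a b, M a -> M b -> lact a (pow0 b) = pow0 (a \o b);
  powS : forall n, E -> pow n -> pow n.+1;
  powS_tensor : forall n, is_tensor (@powS n);
  fk :> wcorr;
  coord : forall n, fk -> pow n;
  coord_linear : forall n, linear (@coord n);
  coord_ract : forall n x a, M a -> coord n (ract x a) = ract (coord n x) a;
  coord_lact : forall n x a, M a -> coord n (lact a x) = lact a (coord n x);
  coord_ip : forall x y w, predual (M : set _) w ->
    series (fun n => w (ip (coord n x) (coord n y)) : R[i]^o) @ \oo
      --> (w (ip x y) : R[i]^o);
  coord_surj : forall s : (forall n, pow n),
    (exists c : R, forall N : nat,
       opnorm (\sum_(n < N) ip (s n) (s n)) <= c) ->
    exists x, forall n, coord n x = s n;
  create : E -> fk -> fk;
  create0 : forall xi x, coord 0 (create xi x) = 0;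
  createS : forall xi x n, coord n.+1 (create xi x) = powS xi (coord n x) }.

Implicit Types (H K : hilbert R).

Record normal_rep H (s : vn_map M -> H -> H) : Prop := NormalRep {
  rep_bounded : forall a, M a -> bounded_op (s a);
  rep_linear : forall a b (c : R[i]), M a -> M b ->
    s (c *: a + b) = c *: s a + s b;
  rep_comp : forall a b, M a -> M b -> s (a \o b) = s a \o s b;
  rep_id : s id = id;
  rep_adj : forall a, M a -> s (adj a) = adj (s a);
  rep_normal : weak_continuous (M : set _) (predual (M : set _))
                 (predual (@bounded_op R H H)) s }.

(* X is the Hilbert space E \otimes_s H (the Hausdorff completion of the
   algebraic tensor product), with elementary tensors t x h. *)
Record is_hilbert_tensor (E : hmod) H (s : vn_map M -> H -> H) (X : hilbert R)
    (t : E -> H -> X) : Prop := IsHilbertTensor {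
  htensor_linearl : forall h, linear (t^~ h);
  htensor_linearr : forall x, linear (t x);
  htensor_dot : forall x h y k, dot (t x h) (t y k) = dot h (s (ip x y) k);
  htensor_dense : closure (tensor_span t) = setT }.

(* Norm of a matrix over E in the linking algebra of E, that is as an operator
   from the direct sum of n copies of M to that of n copies of E. *)
Definition mx_norm_hmod (E : hmod) n (x : 'I_n -> 'I_n -> E) : R :=
  Num.sqrt (opmx_norm (fun i j => \sum_k ip (x k i) (x k j))).

Definition completely_contractive (E : hmod) H (T : E -> H -> H) : Prop :=
  forall n (x : 'I_n -> 'I_n -> E),
    opmx_norm (fun i j => T (x i j)) <= mx_norm_hmod x.

Record cc_cov_rep (E : wcorr) H (T : E -> H -> H) (s : vn_map M -> H -> H)
    : Prop := CCCovRep {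
  cov_normal : normal_rep s;
  cov_bounded : forall x, bounded_op (T x);
  cov_linear : linear T;
  cov_cc : completely_contractive T;
  cov_bimod : forall a x b, M a -> M b ->
    T (lact a (ract x b)) = s a \o T x \o s b;
  cov_continuous : weak_continuous setT (@sigma_fun E)
                     (predual (@bounded_op R H H)) T }.

Record isometric_cov_rep (E : wcorr) K (V : E -> K -> K) (p : vn_map M -> K -> K)
    : Prop := IsometricCovRep {
  iso_cov : cc_cov_rep V p;
  iso_ip : forall x y, adj (V x) \o V y = p (ip x y) }.

(* (V, p) on K is a minimal isometric dilation of (T, s) on H; H is identified
   with a subspace of K by means of the isometry W. *)
Record minimal_isometric_dilation (E : wcorr)
    H (T : E -> H -> H) (s : vn_map M -> H -> H)
    K (V : E -> K -> K) (p : vn_map M -> K -> K) (W : H -> K)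
    (P := W \o adj W) : Prop := MinimalIsometricDilation {
  dil_isometric : isometric_cov_rep V p;
  dil_W_linear : linear W;
  dil_W_isometry : forall h k, dot (W h) (W k) = dot h k;
  dil_commutes : forall a, M a -> p a \o P = P \o p a;
  dil_rep : forall a, M a -> p a \o W = W \o s a;
  dil_coinvariant : forall x h, exists h', adj (V x) (W h) = W h';
  dil_compression : forall x, P \o V x \o W = W \o T x;
  dil_minimal : forall S : set K,
    closed S -> (forall (c : R[i]) k l, S k -> S l -> S (c *: k + l)) ->
    (forall h, S (W h)) ->
    (forall a k, M a -> S k -> S (p a k)) ->
    (forall x k, S k -> S (V x k)) ->
    (forall x k, S k -> S (adj (V x) k)) ->
    S = setT }.

(* (V0, p0) is the covariant representation on K0 = F(E) \otimes_pi0 H0 induced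
   by pi0: V0 x = T_x \otimes I and p0 a = phi_infty(a) \otimes I. *)
Record induced_by (E : wcorr) (F : fock E) (H0 : hilbert R)
    (pi0 : vn_map M -> H0 -> H0) (K0 : hilbert R) (t : F -> H0 -> K0)
    (V0 : E -> K0 -> K0) (p0 : vn_map M -> K0 -> K0) : Prop := InducedBy {
  ind_normal : normal_rep pi0;
  ind_space : is_hilbert_tensor pi0 t;
  ind_bounded : forall x, bounded_op (V0 x);
  ind_rep_bounded : forall a, M a -> bounded_op (p0 a);
  ind_create : forall x y h, V0 x (t y h) = t (create x y) h;
  ind_lact : forall a y h, M a -> p0 a (t y h) = t (lact a y) h }.

Record unitarily_equivalent (E : wcorr) K (V : E -> K -> K) (p : vn_map M -> K -> K)
    (K0 : hilbert R) (V0 : E -> K0 -> K0) (p0 : vn_map M -> K0 -> K0)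
    (U : K -> K0) : Prop := UnitarilyEquivalent {
  ue_linear : linear U;
  ue_isometry : forall k l, dot (U k) (U l) = dot k l;
  ue_surj : forall k0, exists k, U k = k0;
  ue_V : forall x, U \o V x = V0 x \o U;
  ue_p : forall a, M a -> U \o p a = p0 a \o U }.

Definition is_induced (E : wcorr) (F : fock E) K
    (V : E -> K -> K) (p : vn_map M -> K -> K) : Prop :=
  exists (H0 : hilbert R) (pi0 : vn_map M -> H0 -> H0)
         (K0 : hilbert R) (t : F -> H0 -> K0)
         (V0 : E -> K0 -> K0) (p0 : vn_map M -> K0 -> K0) (U : K -> K0),
    induced_by pi0 t V0 p0 /\ unitarily_equivalent V p V0 p0 U.

End Modules.

(* Main.v *)
Require Import Defs.
From HB Require Import structures.
From mathcomp Require Import all_boot all_order all_algebra.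
From mathcomp Require Import complex.
From mathcomp Require Import all_classical all_reals all_analysis.
From mathcomp Require Import ring lra.

Set Implicit Arguments.
Unset Strict Implicit.
Unset Printing Implicit Defensive.

Import Order.TTheory GRing.Theory Num.Theory numFieldNormedType.Exports.
Local Open Scope classical_set_scope.
Local Open Scope ring_scope.
Local Open Scope complex_scope.

(** [adj Ttilde] is a strict contraction, so [1 - Ttilde (adj Ttilde)] has an
invertible square root [b] commuting with [sigma M].  The isometry
[Theta : xi (x) h |-> V xi (W h)] satisfies [adj (V xi) (W - Theta (adj Ttilde)) = 0],
and [J = (W - Theta (adj Ttilde)) b^-1] is an isometry of [H] into the wandering
space of [V] which intertwines [sigma] and [pi].  Hence [(V, pi)] is induced by
[sigma] itself: the maps [t_n : E^n (x) H -> K] determined by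
[t_0 a h = pi a (J h)] and [t_{n+1} (xi (x) y) h = V xi (t_n y h)] add up to an
isometry of [F(E) (x) H] into [K].  Its range is reducing, and the part [A] of [W]
orthogonal to it satisfies [|A| <= |Ttilde| |A|], so [A = 0] and minimality makes
the range all of [K].

The elementary tensors only span a sigma-dense subspace of [E^{n+1}], so
[t_{n+1}] is defined by continuity in the seminorms
[x |-> <h, sigma(<x, x>) h>^{1/2}]: the functional given by the distance from [z]
to that subspace in such a seminorm is shown to be sigma-continuous. *)

(** Strictness of the bound enters twice. It keeps [1 - Ttilde (adj Ttilde)] bounded below, so that
    the wandering space is parametrized by all of [H]; and it makes the estimate on [A]
    self-improving. For [Q] the projection onto the orthogonal complement of the reducing range,
    [Q (Theta (xi (x) h)) = V xi (A h)], so [Q Theta] acts like [I (x) A]. Bounding it by [A] uses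
    that [adj A \o A] commutes with [sigma M], which lets a square root act on the second tensor
    factor.

    Sigma-density only provides approximation tested by functionals, while vectors of [K] have to be
    produced as norm limits. For fixed [h] the form [<h, sigma(<x, y>) h>] is a semi-inner product
    on the module; a sequence minimizing the distance to a subspace is Cauchy for it, and its
    residual defines the functional to be tested. For this, normality of [sigma], given as a
    condition with finitely many functionals near a point, has to be turned into membership of
    [a |-> <h, sigma(a) k>] in the predual.

    No separate model of the induced space is built: [K] itself turns out to be one. *)

Lemma cvgn_ext (T : topologicalType) (u v : nat -> T) (l : T) :
  (forall n, u n = v n) -> u @ \oo --> l -> v @ \oo --> l.
Proof. by move=> uv; rewrite (funext uv). Qed.

Lemma cvgn_le_cst (R : realType) (u : nat -> R) (l c : R) :
  u @ \oo --> l -> (forall n, u n <= c) -> l <= c.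
Proof.
move=> ul uc; apply: (closed_cvg (fun z : R => z <= c) (@closed_le R c) _ _ ul).
exact: nearW.
Qed.

(** * Real-valued norms and convergence of sequences *)

Section Norm.
Variable R : realType.

Section Zmodule.
Variable V : normedZmodType R[i].
Implicit Types x y : V.

Lemma nrmE x : `|x| = (nrm x)%:C.
Proof. by rewrite /nrm RRe_real // normr_real. Qed.

Lemma nrm_ge0 x : 0 <= nrm x.
Proof. by rewrite -ler0c -nrmE. Qed.

Lemma nrm0 : nrm (0 : V) = 0.
Proof. by rewrite /nrm normr0. Qed.

Lemma nrm_eq0 x : nrm x = 0 -> x = 0.
Proof. by move=> x0; apply/eqP; rewrite -normr_eq0 nrmE x0. Qed.

Lemma nrmN x : nrm (- x) = nrm x.
Proof. by rewrite /nrm normrN. Qed.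

Lemma nrmBC x y : nrm (x - y) = nrm (y - x).
Proof. by rewrite -nrmN opprB. Qed.

Lemma nrmD x y : nrm (x + y) <= nrm x + nrm y.
Proof. by rewrite -lecR rmorphD /= -!nrmE ler_normD. Qed.

Lemma nrm_tri x y z : nrm (x - z) <= nrm (x - y) + nrm (y - z).
Proof. by rewrite -{1}(subrK y x) -addrA nrmD. Qed.

End Zmodule.

Lemma nrmZ (V : normedModType R[i]) (c : R[i]) (x : V) :
  nrm (c *: x) = nrm c * nrm x.
Proof. by apply: complexI; rewrite rmorphM /= -!nrmE normrZ. Qed.

Lemma nrmM (a b : R[i]) : nrm (a * b) = nrm a * nrm b.
Proof. by apply: complexI; rewrite rmorphM /= -!nrmE normrM. Qed.

Lemma nrm_real (a : R) : nrm (a%:C : R[i]) = `|a|.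
Proof. by rewrite /nrm normc_def /= expr0n /= addr0 sqrtr_sqr. Qed.

Lemma nrm_conj (a : R[i]) : nrm (Num.conj a) = nrm a.
Proof. by rewrite /nrm norm_conjC. Qed.

Lemma Re_le_nrm (a : R[i]) : `|complex.Re a| <= nrm a.
Proof. by rewrite -lecR -nrmE normc_ge_Re. Qed.

Lemma cReB (a b : R[i]) : complex.Re (a - b) = complex.Re a - complex.Re b.
Proof. by case: a; case: b. Qed.
Lemma cReD (a b : R[i]) : complex.Re (a + b) = complex.Re a + complex.Re b.
Proof. by case: a; case: b. Qed.
Lemma cReN (a : R[i]) : complex.Re (- a) = - complex.Re a.
Proof. by case: a. Qed.
Lemma cReZ (a : R) (b : R[i]) : complex.Re (a%:C * b) = a * complex.Re b.
Proof. by case: b => u v /=; rewrite mul0r subr0. Qed.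
Lemma cRe_conj (a : R[i]) : complex.Re (Num.conj a) = complex.Re a.
Proof. by case: a. Qed.
Lemma ger0_RRe (a : R[i]) : 0 <= a -> a = (complex.Re a)%:C.
Proof. by move=> a0; rewrite RRe_real // ger0_real. Qed.
Lemma conj_mul_nrm (a : R[i]) : Num.conj a * a = (nrm a ^+ 2)%:C.
Proof. by rewrite rmorphXn /= -nrmE normCKC. Qed.

Section Cvg.
Variable V : normedModType R[i].
Implicit Types (u : nat -> V) (l : V).

Lemma cvg_nrmP u l : u @ \oo --> l <->
  (forall e : R, 0 < e -> \forall n \near \oo, nrm (u n - l) < e).
Proof.
split.
  move=> /cvgrPdist_lt h e e0.
  have e0' : 0 < e%:C by rewrite ltcR.
  by apply: filterS (h _ e0') => n; rewrite nrmE ltcR nrmBC.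
move=> h; apply/cvgrPdist_lt => e e0.
have [e' ee] : exists e', e = e'%:C by apply/complex_realP; rewrite gtr0_real.
move: e0; rewrite ee ltcR => e0.
by apply: filterS (h _ e0) => n; rewrite nrmE ltcR nrmBC.
Qed.

Lemma cvg_nrm0P u l : u @ \oo --> l <-> (fun n => nrm (u n - l)) @ \oo --> (0 : R).
Proof.
rewrite cvg_nrmP; split.
  move=> h; apply/cvgrPdist_lt => e e0; apply: filterS (h _ e0) => n.
  by rewrite sub0r normrN ger0_norm // nrm_ge0.
move=> /cvgrPdist_lt h e e0; apply: filterS (h _ e0) => n.
by rewrite sub0r normrN ger0_norm // nrm_ge0.
Qed.

Lemma cvg_nrm_le u l (r : nat -> R) :
  (forall n, nrm (u n - l) <= r n) -> r @ \oo --> (0 : R) -> u @ \oo --> l.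
Proof.
move=> ur r0; apply/cvg_nrm0P; apply: (squeeze_cvgr _ _ r0); last exact: (@cvg_cst R).
by apply: nearW => n; rewrite nrm_ge0 ur.
Qed.

Lemma cvgn_lim_eq u v k l :
  u @ \oo --> k -> v @ \oo --> l -> (forall n, u n = v n) -> k = l.
Proof.
move=> uk vl uv; have uk' : v @ \oo --> k by apply: cvgn_ext uk.
exact: (cvg_unique _ uk' vl).
Qed.

Lemma cvgn_shift u l : u @ \oo --> l -> (fun n => u n.+1) @ \oo --> l.
Proof. by have := @cvg_shiftS V u (nbhs l); move=> /propeqP[_]. Qed.

Lemma cvg_nrm u l : u @ \oo --> l -> (fun n => nrm (u n)) @ \oo --> nrm l.
Proof.
move=> /cvg_nrmP h; apply/cvgrPdist_lt => e e0; apply: filterS (h _ e0) => n.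
apply: le_lt_trans; rewrite ler_norml; apply/andP; split.
  by rewrite lerNl opprB lerBlDr -{1}(subrK l (u n)) nrmD.
by rewrite lerBlDr nrmBC -{1}(subrK (u n) l) nrmD.
Qed.

Lemma closed_seq (S : set V) u l :
  closed S -> (forall n, S (u n)) -> u @ \oo --> l -> S l.
Proof. by move=> cS Su; apply: (closed_cvg S cS); apply: nearW. Qed.

Lemma closureP (S : set V) l : closure S l <->
  exists2 u : nat -> V, forall n, S (u n) & u @ \oo --> l.
Proof.
split; last first.
  case=> u Su ul; apply: (@closed_seq _ u) => // [|n]; first exact: closed_closure.
  exact: subset_closure.
move=> Sl.
have /choice[u uP] : forall n : nat, exists x, S x /\ nrm (x - l) < n.+1%:R^-1.
  move=> n; have /nbhs_ballP : nbhs l (ball l (n.+1%:R^-1 : R[i])).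
    by apply: nbhsx_ballx; rewrite invr_gt0 ltr0n.
  have := Sl (ball l (n.+1%:R^-1 : R[i])).
  case=> [|x [Sx bx] _].
    by apply: nbhsx_ballx; rewrite invr_gt0 ltr0n.
  exists x; split => //; move: bx; rewrite -ball_normE /= nrmE.
  rewrite -[n.+1%:R](rmorph_nat (real_complex R)) -fmorphV /= ltcR nrmBC.
  exact.
exists u => [n|]; first by case: (uP n).
apply: (@cvg_nrm_le _ _ (fun n => n.+1%:R^-1)); last exact: cvg_harmonic.
by move=> n; apply: ltW; case: (uP n).
Qed.

End Cvg.

Lemma cauchy_nrm (V : completeNormedModType R[i]) (u : nat -> V) (r : nat -> R) :
  (forall m n, (m <= n)%N -> nrm (u n - u m) <= r m) -> r @ \oo --> (0 : R) ->
  exists l : V, u @ \oo --> l.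
Proof.
move=> ur r0; exists (lim (u @ \oo)).
suff : cvg (u @ \oo) by [].
apply: cauchy_cvg; apply: cauchy_exP => e e0.
have [e' ee] : exists e', e = e'%:C by apply/complex_realP; rewrite gtr0_real.
move: e0; rewrite ee ltcR => e0.
move/cvgrPdist_lt : r0 => /(_ _ e0) [N _ hN].
exists (u N); exists N => // n /= Nn.
rewrite -ball_normE /= nrmE ltcR nrmBC.
apply: le_lt_trans (ur _ _ Nn) _.
have := hN N (leqnn N); rewrite sub0r normrN.
exact: le_lt_trans (ler_norm _).
Qed.

End Norm.

Section HarmonicSqrt.
Variable R : realType.

Lemma cvg_sqrt_harmonic : (fun n => Num.sqrt n.+1%:R^-1 : R) @ \oo --> (0 : R).
Proof.
have := @cvg_comp _ _ _ _ (@Num.sqrt R) _ _ _ (@cvg_harmonic R) (@sqrt_continuous R 0).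
by rewrite sqrtr0.
Qed.

Lemma cvg_double_sqrt_harmonic : (fun n => 2 * Num.sqrt n.+1%:R^-1 : R) @ \oo --> (0 : R).
Proof. by rewrite -(mulr0 2); apply: cvgMr; exact: cvg_sqrt_harmonic. Qed.

End HarmonicSqrt.

(** * Semi-inner products *)

Section HermitianForm.
Variables (R : realType) (V : lmodType R[i]).

(** Degenerate forms are allowed. Besides [dot], the instances are [<x, a y>] for a positive
    operator [a] and [<h, s(<x, y>) h>] on a Hilbert module. *)
Record psd_form (f : V -> V -> R[i]) : Prop := PsdForm {
  psd_linear : forall x, linear_for *%R (f x);
  psd_conj : forall x y, f y x = Num.conj (f x y);
  psd_ge0 : forall x, 0 <= f x x }.

Variables (f : V -> V -> R[i]) (hf : psd_form f).

Lemma psdD x y z : f x (y + z) = f x y + f x z.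
Proof. by have := psd_linear hf x 1 y z; rewrite scale1r mul1r. Qed.

Lemma psd0 x : f x 0 = 0.
Proof. by apply: (addrI (f x 0)); rewrite -psdD !addr0. Qed.

Lemma psdZ x a y : f x (a *: y) = a * f x y.
Proof. by have := psd_linear hf x a y 0; rewrite !addr0 psd0 addr0. Qed.

Lemma psdN x y : f x (- y) = - f x y.
Proof. by rewrite -scaleN1r psdZ mulN1r. Qed.

Lemma psdB x y z : f x (y - z) = f x y - f x z.
Proof. by rewrite psdD psdN. Qed.

Lemma psdDl x y z : f (x + y) z = f x z + f y z.
Proof. by rewrite (psd_conj hf z) psdD rmorphD /= -!(psd_conj hf). Qed.

Lemma psd0l x : f 0 x = 0.
Proof. by rewrite (psd_conj hf) psd0 rmorph0. Qed.

Lemma psdZl a x y : f (a *: x) y = Num.conj a * f x y.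
Proof. by rewrite (psd_conj hf y) psdZ rmorphM /= -!(psd_conj hf). Qed.

Lemma psdNl x y : f (- x) y = - f x y.
Proof. by rewrite (psd_conj hf y) psdN rmorphN /= -(psd_conj hf). Qed.

Lemma psdBl x y z : f (x - y) z = f x z - f y z.
Proof. by rewrite psdDl psdNl. Qed.

Lemma psd_sum x n (y : 'I_n -> V) : f x (\sum_i y i) = \sum_i f x (y i).
Proof. exact: (big_morph (f x) (psdD x) (psd0 x)). Qed.

Lemma psd_suml x n (y : 'I_n -> V) : f (\sum_i y i) x = \sum_i f (y i) x.
Proof. exact: (big_morph (f^~ x) (fun y z => psdDl y z x) (psd0l x)). Qed.

Definition psd_q x : R := complex.Re (f x x).

Lemma psd_qE x : f x x = (psd_q x)%:C.
Proof. exact/ger0_RRe/psd_ge0. Qed.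

Lemma psd_q_ge0 x : 0 <= psd_q x.
Proof. by rewrite -ler0c -psd_qE psd_ge0. Qed.

Lemma psd_CS x y : nrm (f x y) ^+ 2 <= psd_q x * psd_q y.
Proof.
(* Positivity at [q(v) u - conj b v] gives [q(v)] times the discriminant, without a division; it is
   informative only if [q(v)] is positive, whence the cases below. *)
have key u v : 0 <= psd_q v * (psd_q u * psd_q v - nrm (f u v) ^+ 2).
  set b := f u v.
  have := psd_ge0 hf ((psd_q v)%:C *: u - Num.conj b *: v).
  rewrite psdBl !psdB !psdZ !psdZl !psd_qE (psd_conj hf u v) -/b.
  rewrite conjCK (_ : Num.conj (psd_q v)%:C = (psd_q v)%:C); last first.
    by apply: CrealP; rewrite complex_real.
  set e := (X in 0 <= X -> _).
  rewrite (_ : e = (psd_q v * (psd_q u * psd_q v - nrm b ^+ 2))%:C) ?ler0c //.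
  by rewrite rmorphM rmorphB rmorphM /= -conj_mul_nrm /e; ring.
have [y0|] := ltrP 0 (psd_q y).
  by have := key x y; rewrite pmulr_rge0 // subr_ge0.
rewrite le_eqVlt ltNge psd_q_ge0 orbF => /eqP y0.
have [x0|] := ltrP 0 (psd_q x).
  have := key y x; rewrite pmulr_rge0 // subr_ge0 mulrC.
  by rewrite (psd_conj hf) nrm_conj.
rewrite le_eqVlt ltNge psd_q_ge0 orbF => /eqP x0.
(* Both vectors are null here, and the form at this combination equals [-2 |f x y|^2]. *)
have := psd_ge0 hf (x - Num.conj (f x y) *: y).
rewrite psdBl !psdB !psdZ !psdZl !psd_qE x0 y0 (psd_conj hf x y) conjCK.
rewrite conj_mul_nrm [f x y * _]mulrC conj_mul_nrm !mulr0 sub0r subr0 -opprD.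
rewrite -rmorphD -rmorphN ler0c => h.
by lra.
Qed.

Lemma psd_par x y : psd_q (x + y) + psd_q (x - y) = 2 * psd_q x + 2 * psd_q y.
Proof.
rewrite /psd_q psdBl psdDl !psdB !psdD !cReB !cReD; ring.
Qed.

Lemma psd_qZ a x : psd_q (a *: x) = nrm a ^+ 2 * psd_q x.
Proof. by rewrite /psd_q psdZ psdZl mulrA [a * _]mulrC conj_mul_nrm cReZ. Qed.

Lemma psd_qDZ (a : R) x y :
  psd_q (x + a%:C *: y) = psd_q x + 2 * a * complex.Re (f x y) + a ^+ 2 * psd_q y.
Proof.
rewrite /psd_q psdDl !psdD !psdZ !psdZl (_ : Num.conj a%:C = a%:C); last first.
  by apply: CrealP; rewrite complex_real.
by rewrite (psd_conj hf x y) !cReD !cReZ cRe_conj; ring.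
Qed.

Lemma discr_le (w q e : R) : 0 <= q -> 0 < e ->
  (forall a, 0 <= 2 * a * w + a ^+ 2 * q + e) -> w ^+ 2 <= e * q.
Proof.
move=> q0 e0 h.
have [{}q0|] := ltrP 0 q.
  have := h (- w / q); rewrite -(pmulr_rge0 _ q0).
  rewrite (_ : q * _ = e * q - w ^+ 2) ?subr_ge0 //.
  by field; rewrite gt_eqF.
move=> q0'; have {q0 q0'} q0 : q = 0 by apply/eqP; rewrite eq_le q0 q0'.
rewrite q0 mulr0; have [->|w0] := eqVneq w 0; first by rewrite expr0n.
have := h (- e / w); rewrite q0 mulr0 addr0.
rewrite (_ : _ + _ = - e); last by field.
by rewrite oppr_ge0 leNgt e0.
Qed.

(* Minimization of [q s - 2 Re (g s)] over [S]; for [g = f z] this is the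
   minimization of the distance from [z] to [S]. *)
Lemma minimizing_sequence (S : set V) (g : V -> R[i]) :
  S 0 -> (forall a x y, S x -> S y -> S (a *: x + y)) -> linear_for *%R g ->
  (exists b, forall x, S x -> b <= psd_q x - 2 * complex.Re (g x)) ->
  exists u : nat -> V, [/\ forall n, S (u n),
    forall m n, (m <= n)%N -> psd_q (u n - u m) <= 4 * m.+1%:R^-1 &
    forall n x, S x -> nrm (f (u n) x - g x) ^+ 2 <= n.+1%:R^-1 * psd_q x].
Proof.
move=> S0 lS lg [b hb].
have gD x y : g (x + y) = g x + g y by have := lg 1 x y; rewrite scale1r mul1r.
have g0 : g 0 = 0 by apply: (addrI (g 0)); rewrite -gD !addr0.
have gZ a x : g (a *: x) = a * g x by have := lg a x 0; rewrite g0 !addr0.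
have SZ a x : S x -> S (a *: x) by move=> Sx; rewrite -[_ *: _]addr0; apply: lS.
have SD x y : S x -> S y -> S (x + y).
  by move=> Sx Sy; rewrite -(scale1r x); apply: lS.
pose phi x := psd_q x - 2 * complex.Re (g x).
pose D := [set phi x | x in S].
have Dinf : has_inf D.
  by split; [exists (phi 0), 0|exists b => _ [x Sx <-]; exact: hb].
pose d := inf D.
have dle x : S x -> d <= phi x by move=> Sx; apply: ge_inf; [case: Dinf|exists x].
have /choice[u hu] : forall n : nat, exists x, S x /\ phi x < d + n.+1%:R^-1.
  move=> n; have e0 : 0 < n.+1%:R^-1 :> R by rewrite invr_gt0 ltr0Sn.
  by have [_ [x Sx <-] h] := inf_adherent e0 Dinf; exists x.
have Su n : S (u n) by case: (hu n).
exists u; split=> // [m n mn|n x Sx].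
  (* The midpoint of [u m] and [u n] lies in [S], so its value is at least [d]. With the
     parallelogram law this bounds the squared distance by [2/(m+1) + 2/(n+1)]. *)
  have := dle _ (SZ (2^-1)%:C _ (SD _ _ (Su m) (Su n))).
  have [_] := hu m; have [_] := hu n; have := psd_par (u n) (u m).
  rewrite /phi psd_qZ gZ gD cReZ cReD nrm_real ger0_norm ?invr_ge0 //.
  rewrite [u m + _]addrC.
  have : n.+1%:R^-1 <= m.+1%:R^-1 :> R by rewrite lef_pV2 ?posrE // ler_nat.
  set e1 := n.+1%:R^-1; set e2 := m.+1%:R^-1; rewrite expr2; move: e1 e2 => e1 e2 *; lra.
have e0 : 0 < n.+1%:R^-1 :> R by rewrite invr_gt0 ltr0Sn.
have key y : S y -> complex.Re (f (u n) y - g y) ^+ 2 <= n.+1%:R^-1 * psd_q y.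
  move=> Sy; apply: discr_le => // [|a]; first exact: psd_q_ge0.
  have := dle _ (SD _ _ (Su n) (SZ a%:C _ Sy)).
  rewrite cReB /phi psd_qDZ gD gZ cReD cReZ.
  have [_] := hu n; rewrite /phi; set e := n.+1%:R^-1; move: e => e *; lra.
(* Real variations only control a real part; multiplying [x] by the conjugate of the error turns the
   squared modulus of the error into that real part. *)
have := key _ (SZ (Num.conj (f (u n) x - g x)) _ Sx).
rewrite psdZ gZ -mulrBr conj_mul_nrm /= psd_qZ nrm_conj mulrCA.
have [->|w0] := eqVneq (nrm (f (u n) x - g x)) 0.
  by rewrite expr0n /= => _; rewrite mulr_ge0 ?psd_q_ge0 // ltW.
by rewrite expr2 ler_pM2l // lt_def sqr_ge0 expf_neq0.
Qed.

End HermitianForm.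

(** * Hilbert spaces *)

Section Hilbert.
Variables (R : realType).
Implicit Types H K : hilbert R.

Lemma dot_psd H : psd_form (@dot R H).
Proof.
split=> [||x]; [exact: dot_linear|exact: dot_conj|].
by rewrite dot_norm exprn_ge0.
Qed.

Section One.
Variable H : hilbert R.
Implicit Types x y z : H.
Let p := dot_psd H.

Definition dotD := psdD p.
Definition dotB := psdB p.
Definition dotZ := psdZ p.
Definition dot0 := psd0 p.
Definition dotDl := psdDl p.
Definition dotBl := psdBl p.
Definition dotZl := psdZl p.
Definition dot0l := psd0l p.
Definition dot_sum := psd_sum p.
Definition dot_suml := psd_suml p.

Lemma dotxx x : dot x x = (nrm x ^+ 2)%:C.
Proof. by rewrite dot_norm rmorphXn /= nrmE. Qed.

Lemma Re_dotxx x : complex.Re (dot x x) = nrm x ^+ 2.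
Proof. by rewrite dotxx. Qed.

Lemma dot_CS x y : nrm (dot x y) <= nrm x * nrm y.
Proof.
rewrite -(@ler_pXn2r _ 2) ?nnegrE ?mulr_ge0 ?nrm_ge0 //.
by have := psd_CS p x y; rewrite /psd_q !Re_dotxx exprMn.
Qed.

Lemma dot_eq0 x : dot x x = 0 -> x = 0.
Proof. by rewrite dotxx => -[] /eqP; rewrite sqrf_eq0 => /eqP/nrm_eq0. Qed.

Lemma dot_inj x y : (forall z, dot z x = dot z y) -> x = y.
Proof.
move=> h; apply/eqP; rewrite -subr_eq0; apply/eqP/dot_eq0.
by rewrite dotB h subrr.
Qed.

Lemma cvg_dotr x (u : nat -> H) l : u @ \oo --> l ->
  (fun n => dot x (u n) : R[i]^o) @ \oo --> (dot x l : R[i]^o).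
Proof.
move=> /cvg_nrm0P ul; apply: (@cvg_nrm_le _ _ _ _ (fun n => nrm x * nrm (u n - l))).
  by move=> n; rewrite -dotB dot_CS.
by rewrite -(mulr0 (nrm x)); apply: cvgMr.
Qed.

Arguments cvg_dotr x {u l} _.

Lemma cvg_conj (u : nat -> R[i]^o) (l : R[i]^o) : u @ \oo --> l ->
  (fun n => Num.conj (u n) : R[i]^o) @ \oo --> (Num.conj l : R[i]^o).
Proof.
move=> /cvg_nrm0P ul; apply/cvg_nrm0P.
by under eq_fun => n do rewrite -rmorphB nrm_conj.
Qed.

Lemma cvg_dotl x (u : nat -> H) l : u @ \oo --> l ->
  (fun n => dot (u n) x : R[i]^o) @ \oo --> (dot l x : R[i]^o).
Proof.
move=> /(cvg_dotr x)/cvg_conj; rewrite -dot_conj.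
by under eq_fun => n do rewrite -dot_conj.
Qed.

End One.
Arguments cvg_dotr {H} x {u l} _.
Arguments cvg_dotl {H} x {u l} _.

Lemma boundedP H K (A : H -> K) : bounded_op A ->
  exists2 c : R, 0 < c & forall x, nrm (A x) <= c * nrm x.
Proof.
case=> _ [c hc]; exists (`|c| + 1) => [|x].
  by rewrite ltr_wpDl.
rewrite (le_trans (hc x)) // ler_wpM2r ?nrm_ge0 //.
by rewrite (le_trans (ler_norm _)) // lerDl.
Qed.

Section Linear.
Variables (U W : lmodType R[i]) (A : U -> W) (hA : linear A).

Lemma linD x y : A (x + y) = A x + A y.
Proof. by have := hA 1 x y; rewrite !scale1r. Qed.
Lemma lin0 : A 0 = 0.
Proof. by apply: (addrI (A 0)); rewrite -linD !addr0. Qed.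
Lemma linZ c x : A (c *: x) = c *: A x.
Proof. by have := hA c x 0; rewrite lin0 !addr0. Qed.
Lemma linN x : A (- x) = - A x.
Proof. by rewrite -scaleN1r linZ scaleN1r. Qed.
Lemma linB x y : A (x - y) = A x - A y.
Proof. by rewrite linD linN. Qed.
Lemma lin_sum n (x : 'I_n -> U) : A (\sum_i x i) = \sum_i A (x i).
Proof. exact: (big_morph A linD lin0). Qed.

End Linear.

Lemma bounded_cvg H K (A : H -> K) (u : nat -> H) l : bounded_op A ->
  u @ \oo --> l -> (fun n => A (u n)) @ \oo --> A l.
Proof.
move=> bA /cvg_nrm0P ul; have [c c0 hc] := boundedP bA.
apply: (@cvg_nrm_le _ _ _ _ (fun n => c * nrm (u n - l))).
  by move=> n; rewrite -(linB bA.1) hc.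
by rewrite -(mulr0 c); apply: cvgMr.
Qed.

Lemma bounded_comp H1 H2 H3 (A : H2 -> H3) (B : H1 -> H2) :
  bounded_op A -> bounded_op B -> bounded_op (A \o B).
Proof.
move=> bA bB; have [c c0 hc] := boundedP bA; have [d d0 hd] := boundedP bB.
split=> [a x y|]; first by rewrite /= bB.1 bA.1.
exists (c * d) => x; rewrite /= (le_trans (hc _)) // -mulrA ler_wpM2l //.
exact: ltW.
Qed.

Lemma bounded_id H : bounded_op (@id H).
Proof. by split=> //; exists 1 => x; rewrite mul1r. Qed.

Lemma bounded_lin H K (A B : H -> K) a :
  bounded_op A -> bounded_op B -> bounded_op (a *: A + B).
Proof.
move=> bA bB; have [c c0 hc] := boundedP bA; have [d d0 hd] := boundedP bB.
split=> [b x y|].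
  by rewrite !fctE bA.1 bB.1 !scalerDr !scalerA mulrC addrACA.
exists (nrm a * c + d) => x; rewrite fctE (le_trans (nrmD _ _)) //.
rewrite mulrDl lerD // nrmZ -mulrA ler_wpM2l ?nrm_ge0 //.
Qed.

Lemma bounded_scale H K (A : H -> K) a : bounded_op A -> bounded_op (a *: A).
Proof.
move=> bA; rewrite -[_ *: _]addr0; apply: bounded_lin => //.
by split=> [? ? ?|]; [rewrite scaler0 addr0|exists 0 => ?; rewrite nrm0 mul0r].
Qed.

(** The vector is the limit of a minimizing sequence for [|x|^2 - 2 Re (g x)] on [S], which is
    bounded below by [- c^2] because [(|x| - c)^2] is nonnegative. Taking [S] to be everything
    yields adjoints, and [g = dot x] yields projections. *)
Lemma riesz H (S : set H) (g : H -> R[i]) (c : R) :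
  closed S -> S 0 -> (forall a x y, S x -> S y -> S (a *: x + y)) ->
  linear_for *%R g -> (forall x, S x -> nrm (g x) <= c * nrm x) ->
  exists2 v, S v & forall x, S x -> dot v x = g x.
Proof.
move=> cS S0 lS lg gc.
have [|u [Su uC ug]] := minimizing_sequence (dot_psd H) S0 lS lg.
  exists (- c ^+ 2) => x /gc; have := Re_le_nrm (g x).
  rewrite ler_norml => /andP[_ h1] h2.
  by rewrite /psd_q Re_dotxx; have := le_trans h1 h2; have := sqr_ge0 (nrm x - c); nra.
have [v uv] : exists v : H, u @ \oo --> v.
  apply: (@cauchy_nrm _ _ _ (fun n => 2 * Num.sqrt n.+1%:R^-1)).
    move=> m n /uC; rewrite /psd_q Re_dotxx => h.
    rewrite -(@ler_pXn2r _ 2) ?nnegrE ?mulr_ge0 ?nrm_ge0 ?sqrtr_ge0 //.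
    by rewrite exprMn sqr_sqrtr ?invr_ge0 // -natrX.
  exact: cvg_double_sqrt_harmonic.
exists v; first exact: (closed_seq cS _ uv).
move=> x Sx.
have h1 := cvg_dotl x uv.
have h2 : (fun n => dot (u n) x : R[i]^o) @ \oo --> (g x : R[i]^o).
  apply: (@cvg_nrm_le _ _ _ _ (fun n => Num.sqrt n.+1%:R^-1 * nrm x)).
    move=> n; rewrite -(@ler_pXn2r _ 2) ?nnegrE ?mulr_ge0 ?nrm_ge0 ?sqrtr_ge0 //.
    rewrite exprMn sqr_sqrtr ?invr_ge0 //.
    by have := ug n x Sx; rewrite /psd_q Re_dotxx.
  by rewrite -(mul0r (nrm x)); apply: cvgMl; exact: cvg_sqrt_harmonic.
exact: (cvg_unique _ h1 h2).
Qed.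

Lemma projection H (S : set H) :
  closed S -> S 0 -> (forall a x y, S x -> S y -> S (a *: x + y)) ->
  exists2 P : H -> H, linear P &
    forall x, S (P x) /\ forall s, S s -> dot s (x - P x) = 0.
Proof.
move=> cS S0 lS.
have /choice[P hP] : forall x, exists v, S v /\ forall s, S s -> dot v s = dot x s.
  move=> x; have [|v] := @riesz H S (dot x) (nrm x) cS S0 lS (dot_linear x).
    by move=> y _; exact: dot_CS.
  by exists v.
have SP x : S (P x) by case: (hP x).
have oP x s : S s -> dot s (x - P x) = 0.
  move=> Ss; case: (hP x) => _ /(_ s Ss) h.
  by rewrite dot_conj dotBl h subrr rmorph0.
exists P; last by move=> x; split=> // s; apply: oP.
move=> a x y; apply/eqP; rewrite -subr_eq0; apply/eqP.
have Sd : S (P (a *: x + y) - (a *: P x + P y)).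
  by rewrite addrC -scaleN1r; apply: (lS) => //; apply: lS.
set d := (X in S X) in Sd; rewrite -/d; apply: dot_eq0.
rewrite {2}/d (_ : _ - _ = a *: (x - P x) + (y - P y) - (a *: x + y - P (a *: x + y))).
  by rewrite dotB dotD dotZ !oP // mulr0 addr0 subrr.
by rewrite scalerBr [in RHS]addrACA -opprD opprB [RHS]addrC addrA subrK.
Qed.

Section Adjoint.
Variables (H K : hilbert R).
Implicit Types A : H -> K.

Lemma adjP A : bounded_op A -> forall x y, dot (adj A y) x = dot y (A x).
Proof.
move=> bA; have [c c0 hc] := boundedP bA.
have /choice[B hB] : forall y, exists v, forall x, dot v x = dot y (A x).
  move=> y.
  have [|//|//|||v _ hv] := @riesz H setT (fun x => dot y (A x)) (nrm y * c).
  - exact: closedT.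
  - by move=> a u v; rewrite bA.1 dotD dotZ.
  - move=> x _; rewrite (le_trans (dot_CS _ _)) // -mulrA.
    by rewrite ler_wpM2l // nrm_ge0.
  by exists v => x; apply: hv.
rewrite /adj; case: xgetP => [B' _ //|] /(_ B) [] x y.
exact: hB.
Qed.

Lemma adjPr A : bounded_op A -> forall x y, dot x (adj A y) = dot (A x) y.
Proof. by move=> bA x y; rewrite dot_conj adjP // -dot_conj. Qed.

Lemma adj_unique A B : (forall x y, dot (B y) x = dot y (A x)) -> adj A = B.
Proof.
move=> hB; rewrite /adj; case: xgetP => [B' _ hB'|/(_ B)[]//].
apply/funext => y; apply: dot_inj => z.
by rewrite dot_conj (hB' z y) -(hB z y) -dot_conj.
Qed.

Lemma adj_le A (c : R) : bounded_op A -> 0 <= c ->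
  (forall x, nrm (A x) <= c * nrm x) -> forall y, nrm (adj A y) <= c * nrm y.
Proof.
move=> bA c0 hc y; have [->|y0] := eqVneq (nrm (adj A y)) 0.
  by rewrite mulr_ge0 ?nrm_ge0.
rewrite -(@ler_pM2r _ (nrm (adj A y))); last by rewrite lt_def y0 nrm_ge0.
rewrite -expr2 -Re_dotxx adjP // (le_trans (ler_norm _)) //.
rewrite (le_trans (Re_le_nrm _)) // (le_trans (dot_CS _ _)) //.
by rewrite [leRHS]mulrAC [leLHS]mulrC ler_wpM2r ?nrm_ge0.
Qed.

Lemma bounded_adj A : bounded_op A -> bounded_op (adj A).
Proof.
move=> bA; have [c c0 hc] := boundedP bA; split=> [a x y|].
  by apply: dot_inj => z; rewrite dotD dotZ !adjPr // dotD dotZ.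
by exists c => y; apply: adj_le => //; exact: ltW.
Qed.

Lemma adj_lin A B a : bounded_op A -> bounded_op B ->
  adj (a *: A + B) = Num.conj a *: adj A + adj B.
Proof.
move=> bA bB; apply: adj_unique => x y.
by rewrite !fctE dotDl dotZl conjCK !adjP // dotD dotZ.
Qed.

Lemma opnorm_le A x : bounded_op A -> nrm (A x) <= opnorm A * nrm x.
Proof.
move=> bA; have [c c0 hc] := boundedP bA.
have [->|x0] := eqVneq x 0; first by rewrite (lin0 bA.1) !nrm0 mulr0.
have {}x0 : 0 < nrm x.
  by rewrite lt_def nrm_ge0 andbT; apply: contra x0 => /eqP/nrm_eq0 ->.
rewrite -ler_pdivrMr //.
rewrite (_ : _ / _ = nrm (A ((nrm x)^-1%:C *: x))); last first.
  rewrite (linZ bA.1) nrmZ nrm_real ger0_norm ?invr_ge0 ?nrm_ge0 //.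
  by rewrite mulrC.
apply: ub_le_sup.
  exists c => _ [y /= y1 <-]; rewrite (le_trans (hc _)) // -[leRHS]mulr1.
  by rewrite ler_wpM2l // ltW.
exists ((nrm x)^-1%:C *: x) => //=.
by rewrite nrmZ nrm_real ger0_norm ?invr_ge0 ?nrm_ge0 // mulVf // gt_eqF.
Qed.

Lemma opnorm_ub A c : 0 <= c -> (forall x, nrm (A x) <= c * nrm x) -> opnorm A <= c.
Proof.
move=> c0 hc; apply: ge_sup; first by exists (nrm (A 0)), 0 => //=; rewrite nrm0.
move=> _ [y /= y1 <-]; rewrite (le_trans (hc _)) // -[leRHS]mulr1.
by rewrite ler_wpM2l.
Qed.

Lemma opnorm_ge0 A : bounded_op A -> 0 <= opnorm A.
Proof.
move=> bA; have [c c0 hc] := boundedP bA.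
rewrite (le_trans (nrm_ge0 (A 0))) //; apply: ub_le_sup.
  exists c => _ [y /= y1 <-]; rewrite (le_trans (hc _)) // -[leRHS]mulr1.
  by rewrite ler_wpM2l // ltW.
by exists 0 => //=; rewrite nrm0.
Qed.

End Adjoint.

Lemma adjK H K (A : H -> K) : bounded_op A -> adj (adj A) = A.
Proof. by move=> bA; apply: adj_unique => x y; rewrite adjPr. Qed.

Lemma adj_comp H1 H2 H3 (A : H2 -> H3) (B : H1 -> H2) :
  bounded_op A -> bounded_op B -> adj (A \o B) = adj B \o adj A.
Proof. by move=> bA bB; apply: adj_unique => x y /=; rewrite !adjP. Qed.

End Hilbert.
Arguments cvg_dotr {R H} x {u l} _.
Arguments cvg_dotl {R H} x {u l} _.

(** * Square roots of strictly positive operators *)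

Section SquareRoot.
Variables (R : realType).

Definition selfadj (H : hilbert R) (a : H -> H) :=
  forall x y, dot (a x) y = dot x (a y).

Definition positive_op (H : hilbert R) (a : H -> H) :=
  [/\ bounded_op a, selfadj a & forall x, 0 <= complex.Re (dot x (a x))].

Section Operators.
Variable H : hilbert R.
Implicit Types (a b c p : H -> H).

Lemma selfadj_Re a x : selfadj a -> dot x (a x) = (complex.Re (dot x (a x)))%:C.
Proof.
move=> sa; rewrite RRe_real //; apply/CrealP.
by rewrite -dot_conj sa.
Qed.

Lemma selfadj_adj a : selfadj a -> adj a = a.
Proof. by move=> sa; apply: adj_unique => x y; rewrite sa. Qed.

Lemma positive_psd a : positive_op a -> psd_form (fun x y => dot x (a y)).
Proof.
case=> ba sa pa; split=> [x k u v|x y|x].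
- by rewrite ba.1 dotD dotZ.
- by rewrite -dot_conj sa.
- by rewrite selfadj_Re // ler0c.
Qed.

(** Cauchy-Schwarz for the form [<x, a y>], at the vectors [a x] and [x], gives
    [|a x|^4 <= r |a x|^2 * r |x|^2]. *)
Lemma positive_norm a (r : R) : 0 <= r -> positive_op a ->
  (forall x, complex.Re (dot x (a x)) <= r * nrm x ^+ 2) ->
  forall x, nrm (a x) <= r * nrm x.
Proof.
move=> r0 pa hr x; have := psd_CS (positive_psd pa) (a x) x.
rewrite dotxx nrm_real ger0_norm ?sqr_ge0 //.
have [->|n0] := eqVneq (nrm (a x)) 0; first by rewrite mulr_ge0 ?nrm_ge0.
have {}n0 : 0 < nrm (a x) by rewrite lt_def n0 nrm_ge0.
move=> h; rewrite -(@ler_pXn2r _ 2) ?nnegrE ?mulr_ge0 ?nrm_ge0 //.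
rewrite -(@ler_pM2l _ (nrm (a x) ^+ 2)) ?exprn_gt0 // -[X in X <= _]expr2.
apply: (le_trans h); rewrite /psd_q.
rewrite [leRHS](_ : _ = (r * nrm (a x) ^+ 2) * (r * nrm x ^+ 2)); last by ring.
by apply: ler_pM; rewrite ?hr //; apply: psd_q_ge0 (positive_psd pa) _.
Qed.

Lemma cvg_geom (u : nat -> H) (C r : R) : 0 <= r -> r < 1 ->
  (forall n, nrm (u n.+1 - u n) <= C * r ^+ n) -> exists l : H, u @ \oo --> l.
Proof.
move=> r0 r1 ur.
have C0 : 0 <= C by have := ur 0; rewrite expr0 mulr1; apply/le_trans/nrm_ge0.
have r1' : 0 < 1 - r by rewrite subr_gt0.
apply: (@cauchy_nrm _ _ _ (fun n => C / (1 - r) * r ^+ n)).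
  move=> m n mn; rewrite -(subnK mn) addnC.
  have : nrm (u (m + (n - m))%N - u m) <=
    C / (1 - r) * r ^+ m - C / (1 - r) * r ^+ (m + (n - m))%N.
    elim: (n - m)%N => [|k IH]; first by rewrite addn0 !subrr nrm0.
    rewrite addnS; apply: le_trans (nrm_tri _ (u (m + k)%N) _) _.
    apply: le_trans (lerD (ur _) IH) _.
    have : C = C / (1 - r) * (1 - r) by rewrite divfK // gt_eqF.
    set D := C / (1 - r); move: D => D ->.
    rewrite exprS le_eqVlt; apply/orP; left; apply/eqP; ring.
  move/le_trans; apply; rewrite lerBlDr lerDl.
  by rewrite !mulr_ge0 ?exprn_ge0 ?invr_ge0 // ltW.
rewrite -(mulr0 (C / (1 - r))); apply: cvgMr; apply: cvg_expr.
by rewrite ger0_norm.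
Qed.

Lemma bounded_le a (r : R) : linear a -> (forall x, nrm (a x) <= r * nrm x) -> bounded_op a.
Proof. by move=> la ra; split=> //; exists r. Qed.

Lemma neumann_inverse a (r : R) : 0 <= r -> r < 1 -> linear a ->
  (forall x, nrm (a x) <= r * nrm x) ->
  exists2 g, bounded_op g & (forall x, g (x - a x) = x) /\ (forall x, g x - a (g x) = x).
Proof.
move=> r0 r1 la ra; have ba := bounded_le la ra.
have r1' : 0 < 1 - r by rewrite subr_gt0.
have low x : (1 - r) * nrm x <= nrm (x - a x).
  have := nrm_tri x (a x) 0; rewrite !subr0; have := ra x; lra.
have inj x y : x - a x = y - a y -> x = y.
  move=> xy; apply/eqP; rewrite -subr_eq0; apply/eqP/nrm_eq0/eqP.
  rewrite eq_le nrm_ge0 andbT -(pmulr_rle0 _ r1') (le_trans (low _)) //.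
  have -> : x - y - a (x - y) = (x - a x) - (y - a y).
    by rewrite (linB la) !opprD !opprK addrACA.
  by rewrite xy subrr nrm0.
have /choice[g hg] : forall x, exists y, y - a y = x.
  move=> x; pose u n := iter n (fun v => x + a v) 0.
  have [|y uy] := @cvg_geom u (nrm x) r r0 r1.
    elim=> [|n IH]; first by rewrite /= (lin0 la) addr0 subr0 expr0 mulr1.
    rewrite [u n.+2]/= [in X in _ - X]/= -/(u n.+1) -/(u n) opprD addrACA subrr add0r.
    rewrite -(linB la) (le_trans (ra _)) // exprS mulrCA ler_wpM2l //.
  exists y; apply/eqP; rewrite subr_eq; apply/eqP.
  have h2 : (fun n => x + a (u n)) @ \oo --> x + a y.
    by apply: cvgD; [exact: cvg_cst|exact: bounded_cvg].
  exact: (cvg_unique _ (cvgn_shift uy) h2).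
exists g; last by split=> [x|x]; [apply: inj|]; rewrite hg.
apply: (@bounded_le _ (1 - r)^-1) => [k x y|x].
  by apply: inj; rewrite hg la opprD addrACA -scalerBr !hg.
by rewrite mulrC ler_pdivlMr // mulrC (le_trans (low _)) // hg.
Qed.

(* For [x] the fixed point of the contraction [y |-> (p + y ^ 2) / 2],
   [(1 - x) ^ 2 = 1 - p]. *)
Lemma sqrt_contraction p (r : R) : 0 <= r -> r < 1 -> linear p -> selfadj p ->
  (forall x, nrm (p x) <= r * nrm x) ->
  exists x, [/\ linear x, selfadj x, forall h, nrm (x h) <= r * nrm h,
    forall h, x h + x h = p h + x (x h) &
    forall a, bounded_op a -> a \o p = p \o a -> a \o x = x \o a].
Proof.
move=> r0 r1 lp sp rp.
pose s n := iter n (fun (y : H -> H) h => (2^-1)%:C *: (p h + y (y h))) (fun=> 0).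
have sS n h : s n.+1 h = (2^-1)%:C *: (p h + s n (s n h)) by [].
have ls n : linear (s n).
  elim: n => [a u v|n IH a u v]; first by rewrite /= scaler0 addr0.
  rewrite !sS !IH lp.
  by rewrite addrACA -scalerDr [LHS]scalerDr !scalerA; congr (_ *: _ + _); rewrite mulrC.
have half (x y : R) : x <= y -> `|2^-1| * (x + x) <= y.
  by move=> xy; rewrite ger0_norm ?invr_ge0 //; lra.
have rs n h : nrm (s n h) <= r * nrm h.
  elim: n h => [|n IH] h; first by rewrite nrm0 mulr_ge0 // nrm_ge0.
  rewrite sS nrmZ nrm_real; apply: le_trans (half _ _ (lexx _)).
  rewrite ler_wpM2l // (le_trans (nrmD _ _)) // lerD // (le_trans (IH _)) //.
  rewrite ler_wpM2l // (le_trans (IH _)) // ler_piMl ?nrm_ge0 //; exact: ltW.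
have ss n : selfadj (s n).
  elim: n => [x y|n IH x y]; first by rewrite dot0l dot0.
  rewrite !sS dotZl dotZ dotD dotDl sp !IH (_ : Num.conj _ = (2^-1)%:C) //.
  by apply: CrealP; rewrite complex_real.
have cs a : bounded_op a -> a \o p = p \o a -> forall n h, a (s n h) = s n (a h).
  move=> ba ap; elim=> [|n IH] h; first by rewrite /= (lin0 ba.1).
  by rewrite !sS (linZ ba.1) (linD ba.1) -[a (p h)]/((a \o p) h) ap !IH.
(* The difference of the squares of consecutive iterates [s'] and [s] is split as
   [s' (s' h - s h) + (s' - s) (s h)]. Each summand gains a factor [r], and the factor [1/2]
   averages the two. *)
have ds n h : nrm (s n.+1 h - s n h) <= r ^+ n * nrm h.
  elim: n h => [|n IH] h.
    rewrite subr0 sS addr0 nrmZ nrm_real expr0 mul1r.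
    apply: le_trans (half _ _ (lexx _)); rewrite ler_wpM2l //.
    rewrite (le_trans (rp _)) // (@le_trans _ _ (nrm h)) ?lerDl ?nrm_ge0 //.
    by rewrite ler_piMl ?nrm_ge0 // ltW.
  rewrite sS [in X in _ - X]sS -scalerBr opprD addrACA subrr add0r nrmZ nrm_real.
  apply: le_trans (half _ _ (lexx _)); rewrite ler_wpM2l //.
  apply: le_trans (nrm_tri _ (s n.+1 (s n h)) _) _; apply: lerD.
    rewrite -(linB (ls _)) (le_trans (rs _ _)) // exprS -mulrA ler_wpM2l //.
  rewrite (le_trans (IH _)) // exprSr -mulrA ler_wpM2l ?exprn_ge0 //.
have /choice[x sx] : forall h, exists l : H, (fun n => s n h) @ \oo --> l.
  by move=> h; apply: (@cvg_geom _ (nrm h) r) => // n; rewrite mulrC ds.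
have lx : linear x.
  move=> a u v.
  have h1 : (fun n => a *: s n u + s n v) @ \oo --> a *: x u + x v.
    by apply: cvgD => //; apply: cvgZl_tmp.
  have h2 : (fun n => s n (a *: u + v)) @ \oo --> a *: x u + x v.
    by apply: cvgn_ext h1 => n; rewrite ls.
  exact: (cvg_unique _ (sx _) h2).
have rx h : nrm (x h) <= r * nrm h.
  exact: (cvgn_le_cst (cvg_nrm (sx h)) (fun n => rs n h)).
have bx := bounded_le lx rx.
exists x; split=> //.
- move=> u v; have h1 := cvg_dotl v (sx u); have h2 := cvg_dotr u (sx v).
  have h3 : (fun n => dot (s n u) v : R[i]^o) @ \oo --> (dot u (x v) : R[i]^o).
    by apply: cvgn_ext h2 => n; rewrite ss.
  exact: (cvg_unique _ h1 h3).
- move=> h.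
  have h1 : (fun n => s n (s n h)) @ \oo --> x (x h).
    have z1 : (fun n => s n (s n h - x h)) @ \oo --> (0 : H).
      apply: (@cvg_nrm_le _ _ _ _ (fun n => r * nrm (s n h - x h))).
        by move=> n; rewrite subr0 rs.
      by rewrite -(mulr0 r); apply: cvgMr; apply/cvg_nrm0P.
    have z2 : (fun n => s n (s n h - x h) + s n (x h)) @ \oo --> x (x h).
      by rewrite -[x (x h)]add0r; apply: cvgD.
    by apply: cvgn_ext z2 => n; rewrite -(linD (ls n)) subrK.
  have h2 : (fun n => s n.+1 h) @ \oo --> (2^-1)%:C *: (p h + x (x h)).
    by apply: cvgZl_tmp; apply: cvgD => //; apply: cvg_cst.
  rewrite [in LHS](cvg_unique _ (cvgn_shift (sx h)) h2) // -scalerDl -rmorphD /=.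
  have -> : 2^-1 + 2^-1 = 1 :> R by lra.
  by rewrite scale1r.
- move=> a ba ap; apply/funext => h /=.
  have h1 := bounded_cvg ba (sx h).
  have h2 : (fun n => a (s n h)) @ \oo --> x (a h).
    by apply: cvgn_ext (sx (a h)) => n; rewrite cs.
  exact: (cvg_unique _ h1 h2).
Qed.

End Operators.

(** Dividing by [N] puts [c / N] between [e / N] and [1], so [p = 1 - c / N] is a strict contraction
    and [sqrt N (1 - x)] is the root, [x] being the fixed point above. Its inverse is a Neumann
    inverse, and commutation with [a] passes from [p] to [x] and on to both. *)
Lemma sqrt_op (H : hilbert R) (c : H -> H) (e : R) :
  bounded_op c -> selfadj c -> 0 < e ->
  (forall x, e * nrm x ^+ 2 <= complex.Re (dot x (c x))) ->
  exists b b' : H -> H, [/\ bounded_op b /\ bounded_op b', selfadj b, b \o b = c,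
    b \o b' = id /\ b' \o b = id &
    forall a, bounded_op a -> a \o c = c \o a -> a \o b = b \o a /\ a \o b' = b' \o a].
Proof.
move=> bc sc e0 ec; have [C C0 hC] := boundedP bc.
(* [C] bounds [c]; adding [e] guarantees [e <= N] even when [H] is zero. *)
pose N := C + e; have N0 : 0 < N by rewrite addr_gt0.
have cN (k : R) : Num.conj k%:C = k%:C by apply: CrealP; rewrite complex_real.
pose p x := x - (N^-1)%:C *: c x.
pose r := 1 - e / N.
have r0 : 0 <= r by rewrite subr_ge0 ler_pdivrMr // mul1r lerDr ltW.
have r1 : r < 1 by rewrite gtrBl divr_gt0.
have lp : linear p.
  move=> a x y; rewrite /p bc.1 scalerDr opprD addrACA scalerBr !scalerA.
  by congr (_ - _ *: _ + _); rewrite mulrC.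
have sp : selfadj p by move=> x y; rewrite dotBl dotB dotZl dotZ cN sc.
have Rp x : complex.Re (dot x (p x)) = nrm x ^+ 2 - N^-1 * complex.Re (dot x (c x)).
  by rewrite dotB dotZ cReB cReZ Re_dotxx.
have pp : positive_op p.
  split=> //.
    have -> : p = (- (N^-1)%:C) *: c + id.
      by apply/funext => x; rewrite !fctE scaleNr addrC.
    by apply: bounded_lin => //; apply: bounded_id.
  move=> x; rewrite Rp subr_ge0 ler_pdivrMl //.
  rewrite (le_trans (ler_norm _)) // (le_trans (Re_le_nrm _)) //.
  rewrite (le_trans (dot_CS _ _)) // expr2 mulrA mulrC ler_wpM2r ?nrm_ge0 //.
  rewrite (le_trans (hC x)) // ler_wpM2r ?nrm_ge0 //.
  by rewrite lerDl ltW.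
have rp x : nrm (p x) <= r * nrm x.
  apply: positive_norm => // y; rewrite Rp mulrBl mul1r lerD2l lerN2.
  by rewrite mulrAC mulrC ler_wpM2l // invr_ge0 ltW.
have [x [lx sx rx xE cx]] := sqrt_contraction r0 r1 lp sp rp.
have bx := bounded_le lx rx.
have [g bg [g1 g2]] := neumann_inverse r0 r1 lx rx.
have sN0 : 0 < Num.sqrt N by rewrite sqrtr_gt0.
pose b y := (Num.sqrt N)%:C *: (y - x y).
pose b' y := ((Num.sqrt N)^-1)%:C *: g y.
have bb : bounded_op b.
  have -> : b = (- (Num.sqrt N)%:C) *: x + (Num.sqrt N)%:C *: id.
    by apply/funext => y; rewrite !fctE scaleNr addrC -scalerBr.
  by apply: bounded_lin => //; apply: bounded_scale; exact: bounded_id.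
have bb' : bounded_op b' by exact: (@bounded_scale _ _ _ g).
have b'K y : b (b' y) = y.
  rewrite /b /b' (linZ lx) -scalerBr g2 scalerA -rmorphM mulfV ?scale1r //.
  by rewrite gt_eqF.
have bK y : b' (b y) = y.
  rewrite /b /b' (linZ bg.1) g1 scalerA -rmorphM mulVf ?scale1r //.
  by rewrite gt_eqF.
exists b, b'; split=> //.
- by move=> y z; rewrite /b dotZl dotZ cN dotBl dotB sx.
- apply/funext => y; rewrite /= /b (linZ lx) -scalerBr scalerA -rmorphM -expr2.
  rewrite sqr_sqrtr ?(ltW N0) // (linB lx).
  have -> : y - x y - (x y - x (x y)) = y - p y.
    have -> : p y = x y + x y - x (x y) by rewrite xE addrK.
    by rewrite !opprD !opprK !addrA.
  rewrite /p opprB addrCA subrr addr0 scalerA -rmorphM mulfV ?scale1r //.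
  by rewrite gt_eqF.
- by split; apply/funext.
- move=> a ba ac.
  have ap : a \o p = p \o a.
    apply/funext => y /=; rewrite /p (linB ba.1) (linZ ba.1).
    by rewrite -[a (c y)]/((a \o c) y) ac.
  have ax := cx a ba ap.
  have ab : a \o b = b \o a.
    apply/funext => y /=; rewrite /b (linZ ba.1) (linB ba.1).
    by rewrite -[a (x y)]/((a \o x) y) ax.
  split => //; apply/funext => y /=.
  by rewrite -[LHS]bK -[b (a _)]/((b \o a) _) -ab /= b'K.
Qed.

End SquareRoot.

(** * Ultraweakly continuous functionals *)

Section Interleave.
Variables (R : numFieldType).

(** [predual] asks for one pair of sequences of vectors; interleaving the pairs of two functionals
    gives a pair for their sum. *)
Definition interleave T (u v : nat -> T) n := if odd n then v n./2 else u n./2.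

Lemma half_cvg : (fun n => n./2) @ \oo --> \oo.
Proof.
move=> A [N _ hN]; exists N.*2 => // n /= Nn; apply: hN => /=.
by rewrite geq_half_double.
Qed.

Lemma uphalf_cvg : (fun n => uphalf n) @ \oo --> \oo.
Proof.
move=> A [N _ hN]; exists N.*2 => // n /= Nn; apply: hN => /=.
by rewrite geq_uphalf_double (leq_trans Nn).
Qed.

Lemma series_interleave (W : zmodType) (u v : nat -> W) n :
  series (interleave u v) n = series u (uphalf n) + series v n./2.
Proof.
elim: n => [|n IH]; first by rewrite /series /= !big_geq // addr0.
rewrite seriesSr IH /interleave.
have -> : uphalf n.+1 = n./2.+1 by [].
have -> : n.+1./2 = uphalf n by [].
rewrite uphalf_half; case: (odd n); first by rewrite add1n !seriesSr addrA.
by rewrite add0n !seriesSr addrAC.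
Qed.

Lemma cvg_series_interleave (W : normedModType R) (u v : nat -> W) k l :
  series u @ \oo --> k -> series v @ \oo --> l ->
  series (interleave u v) @ \oo --> k + l.
Proof.
move=> uk vl.
have h : (fun n => series u (uphalf n) + series v n./2) @ \oo --> k + l.
  by apply: cvgD; [exact: (cvg_comp _ _ uphalf_cvg uk)|exact: (cvg_comp _ _ half_cvg vl)].
by apply: cvgn_ext h => n; rewrite series_interleave.
Qed.

Lemma cvg_series_single (W : normedModType R) (u : nat -> W) :
  (forall n, u n.+1 = 0) -> series u @ \oo --> u 0.
Proof.
move=> u0; have h : (fun n => series u n.+1) @ \oo --> u 0.
  apply: (@cvgn_ext _ (fun=> u 0)); last exact: cvg_cst.
  elim=> [|n IH]; first by rewrite seriesSr /series /= big_geq // add0r.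
  by rewrite seriesSr -IH u0 addr0.
by have := @cvg_shiftS W (series u) (nbhs (u 0)); move=> /propeqP[/(_ h)].
Qed.

End Interleave.

Section SpanFunctionals.
Variables (F : fieldType) (V : lmodType F) (S : V -> Prop).
Hypothesis Slin : forall a x y, S x -> S y -> S (a *: x + y).

(** Restricted to [S], because a functional of the predual is constrained only on the algebra. *)
Definition linear_on (f : V -> F) :=
  forall a x y, S x -> S y -> f (a *: x + y) = a * f x + f y.

(** Elimination of one functional: if a vector is killed by all the others but not by the first, a
    multiple of the first is subtracted from [f]; if there is none, the first vanishes wherever the
    others do. *)
Lemma span_functionals n (w : 'I_n -> V -> F) (f : V -> F) :
  (forall i, linear_on (w i)) -> linear_on f ->
  (forall x, S x -> (forall i, w i x = 0) -> f x = 0) ->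
  exists c : 'I_n -> F, forall x, S x -> f x = \sum_i c i * w i x.
Proof.
elim: n w f => [|n IH] w f lw lf wf.
  exists (fun=> 0) => x Sx; rewrite big_ord0; apply: wf => //; case=> //.
have [[x0 [Sx0 w0 w1]]|h] := pselect (exists x0, [/\ S x0,
    forall i, w (lift ord0 i) x0 = 0 & w ord0 x0 != 0]); last first.
  have [|//|x Sx wx|c hc] := IH (fun i => w (lift ord0 i)) f.
  - by move=> i; exact: lw.
  - apply: wf => // i; case: (unliftP ord0 i) => [j ->//|->].
    by apply/eqP; apply: contra_notT h => w1; exists x.
  exists (fun i => if unlift ord0 i is Some j then c j else 0) => x Sx.
  rewrite big_ord_recl unlift_none mul0r add0r hc //.
  by apply: eq_bigr => i _; rewrite liftK.
pose k := f x0 / w ord0 x0.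
have [|||c hc] := IH (fun i => w (lift ord0 i)) (fun x => f x - k * w ord0 x).
- by move=> i; exact: lw.
- move=> a x y Sx Sy; rewrite lf // lw //; ring.
- move=> x Sx wx.
  have Sy : S ((- (w ord0 x / w ord0 x0)) *: x0 + x) by apply: Slin.
  have := wf _ Sy; rewrite lf // => h.
  have /eqP : - (w ord0 x / w ord0 x0) * f x0 + f x = 0.
    apply: h => i; rewrite lw //; case: (unliftP ord0 i) => [j ->|->].
      by rewrite w0 wx mulr0 addr0.
    by rewrite mulNr divfK // addNr.
  rewrite addrC mulNr subr_eq0 => /eqP ->.
  by rewrite /k; field.
exists (fun i => if unlift ord0 i is Some j then c j else k) => x Sx.
rewrite big_ord_recl unlift_none -[LHS](subrK (k * w ord0 x)) hc // addrC.
by congr (_ + _); apply: eq_bigr => i _; rewrite liftK.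
Qed.

End SpanFunctionals.

Section Predual.
Variables (R : realType) (H : hilbert R).
Implicit Types (D : set (H -> H)) (w : (H -> H) -> R[i]).

Lemma predual_on D w w' : (forall a, D a -> w a = w' a) ->
  predual D w -> predual D w'.
Proof.
move=> ww' [x [y [cx cy xyw]]]; exists x, y; split; [exact: cx|exact: cy|].
by move=> a Da; rewrite -(ww' a Da); exact: xyw.
Qed.

Lemma predual_vec D (h k : H) : predual D (fun a => dot h (a k)).
Proof.
pose s (z : H) n := if n is 0%N then z else 0.
exists (s h), (s k); split.
- apply: (cvgP (nrm h ^+ 2)).
  by apply: (@cvg_series_single R R^o (fun n => nrm (s h n) ^+ 2)) => n; rewrite /= nrm0 expr0n.
- apply: (cvgP (nrm k ^+ 2)).
  by apply: (@cvg_series_single R R^o (fun n => nrm (s k n) ^+ 2)) => n; rewrite /= nrm0 expr0n.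
- move=> a Da.
  by apply: (@cvg_series_single R[i] R[i]^o (fun n => dot (s h n) (a (s k n)))) => n; rewrite dot0l.
Qed.

Lemma predual_lin D w1 w2 (c : R[i]) : (forall a, D a -> linear a) ->
  predual D w1 -> predual D w2 -> predual D (fun a => c * w1 a + w2 a).
Proof.
move=> lD [x1 [y1 [cx1 cy1 xy1]]] [x2 [y2 [cx2 cy2 xy2]]].
exists (interleave x1 x2), (interleave (fun n => c *: y1 n) y2); split.
- have /cvgP := @cvg_series_interleave R R^o _ _ _ _ cx1 cx2.
  rewrite (_ : interleave _ _ = (fun n => nrm (interleave x1 x2 n) ^+ 2)) //.
  by apply/funext => n; rewrite /interleave; case: odd.
- have cy1' : series (fun n => nrm (c *: y1 n) ^+ 2) @ \oo -->
     nrm c ^+ 2 * limn (series (fun n => nrm (y1 n) ^+ 2)).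
    rewrite (_ : series _ = (fun n => nrm c ^+ 2 * series (fun n => nrm (y1 n) ^+ 2) n)).
      exact: cvgMr.
    apply/funext => n; rewrite /series /= mulr_sumr; apply: eq_bigr => i _.
    by rewrite nrmZ exprMn.
  have /cvgP := @cvg_series_interleave R R^o _ _ _ _ cy1' cy2.
  rewrite (_ : interleave _ _ = (fun n => nrm (interleave (fun n => c *: y1 n) y2 n) ^+ 2)) //.
  by apply/funext => n; rewrite /interleave; case: odd.
- move=> a Da.
  have h1 : series (fun n => dot (x1 n) (a (c *: y1 n)) : R[i]^o) @ \oo --> (c * w1 a : R[i]^o).
    rewrite (_ : series _ = (fun n => c *: (series (fun n => dot (x1 n) (a (y1 n)) : R[i]^o) n))).
      by apply: cvgZl_tmp; apply: xy1.
    apply/funext => n; rewrite /series /= scaler_sumr; apply: eq_bigr => i _.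
    by rewrite (linZ (lD _ Da)) dotZ.
  have := @cvg_series_interleave R[i] R[i]^o _ _ _ _ h1 (xy2 a Da).
  rewrite (_ : interleave _ _ = (fun n => dot (interleave x1 x2 n)
    (a (interleave (fun n => c *: y1 n) y2 n)))) //.
  by apply/funext => n; rewrite /interleave; case: odd.
Qed.

Lemma predual0 D : predual D (fun=> 0).
Proof.
apply: predual_on (predual_vec D 0 0) => a _; exact: dot0l.
Qed.

Lemma predual_sum D n (c : 'I_n -> R[i]) (w : 'I_n -> (H -> H) -> R[i]) :
  (forall a, D a -> linear a) -> (forall i, predual D (w i)) ->
  predual D (fun a => \sum_i c i * w i a).
Proof.
move=> lD; elim: n c w => [|n IH] c w pw.
  by apply: predual_on (predual0 D) => a _; rewrite big_ord0.
apply: predual_on (predual_lin (c ord0) lD (pw ord0) (IH (fun i => c (lift ord0 i)) _ (fun i => pw (lift ord0 i)))) => a _.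
by rewrite big_ord_recl.
Qed.

Lemma predual_linear_on D w : (forall a, D a -> linear a) ->
  (forall c a b, D a -> D b -> D (c *: a + b)) ->
  predual D w -> linear_on D w.
Proof.
move=> lD Dl [x [y [_ _ xyw]]] c a b Da Db.
have h : (fun n => c *: (series (fun n => dot (x n) (a (y n)) : R[i]^o) n) +
   series (fun n => dot (x n) (b (y n)) : R[i]^o) n) @ \oo --> c * w a + w b.
  by apply: cvgD; [apply: cvgZl_tmp|]; apply: xyw.
have h' : series (fun n => dot (x n) ((c *: a + b) (y n)) : R[i]^o) @ \oo
    --> (c * w a + w b : R[i]^o).
  apply: cvgn_ext h => n; rewrite /series /= scaler_sumr -big_split /=.
  by apply: eq_bigr => i _; rewrite !fctE dotD dotZ.
exact: (cvg_unique _ (xyw _ (Dl c _ _ Da Db)) h').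
Qed.

End Predual.

(** * Von Neumann algebras and normal representations *)

Section VonNeumann.
Variables (R : realType) (M : vnalg R).
Implicit Types a b c : vn_map M.

Lemma vnP a : M a <-> bounded_op a /\
  forall b, commutant M b -> b \o a = a \o b.
Proof. by rewrite {1}vn_bicommutant. Qed.

Lemma vn_linear a : M a -> linear a.
Proof. by case/vn_bounded. Qed.

Lemma vn_lin (k : R[i]) a b : M a -> M b -> M (k *: a + b).
Proof.
move=> Ma Mb; apply/vnP; split; first by apply: bounded_lin; exact: vn_bounded.
move=> c [[lc _] hc]; apply/funext => x /=; rewrite !fctE lc.
by rewrite -[c (a x)]/((c \o a) x) -[c (b x)]/((c \o b) x) -!hc.
Qed.

Lemma vn_id : M id.
Proof. by apply/vnP; split=> //; exact: bounded_id. Qed.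

Lemma vn_comp a b : M a -> M b -> M (a \o b).
Proof.
move=> Ma Mb; apply/vnP; split; first by apply: bounded_comp; exact: vn_bounded.
by move=> c [_ hc]; rewrite compA -(hc a) // -compA -(hc b).
Qed.

Lemma vn_add a b : M a -> M b -> M (a + b).
Proof. by move=> Ma Mb; rewrite -[a]scale1r; apply: vn_lin. Qed.

Lemma vn0 : M 0.
Proof.
by rewrite -(subrr (id : vn_map M)) addrC -scaleN1r; apply: vn_lin; exact: vn_id.
Qed.

Lemma vn_scale k a : M a -> M (k *: a).
Proof. by move=> Ma; rewrite -[_ *: _]addr0; apply: vn_lin => //; exact: vn0. Qed.

Lemma vn_opp a : M a -> M (- a).
Proof. by move=> Ma; rewrite -scaleN1r; apply: vn_scale. Qed.

Lemma vn_sub a b : M a -> M b -> M (a - b).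
Proof. by move=> Ma Mb; apply: vn_add => //; apply: vn_opp. Qed.

Lemma vn_adjK a : M a -> adj (adj a) = a.
Proof. by move=> /vn_bounded/adjK. Qed.

(** Whatever commutes with [M] commutes with [c], hence with its root and the inverse, which
    therefore lie in the bicommutant. *)
Lemma vn_sqrt c (e : R) : M c -> selfadj c -> 0 < e ->
  (forall x, e * nrm x ^+ 2 <= complex.Re (dot x (c x))) ->
  exists b b', [/\ M b, M b', selfadj b, b \o b = c & b \o b' = id /\ b' \o b = id].
Proof.
move=> Mc sc e0 ec.
have [b [b' [[bb bb'] sb bE b'E hb]]] := sqrt_op (vn_bounded Mc) sc e0 ec.
exists b, b'; split=> //; apply/vnP; split=> // a [ba ha].
  by case: (hb a ba) => //; rewrite ha.
by case: (hb a ba) => //; rewrite ha.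
Qed.

End VonNeumann.

Section NormalRep.
Variables (R : realType) (M : vnalg R) (H : hilbert R).
Variables (s : vn_map M -> H -> H) (hs : normal_rep s).
Implicit Types a b c : vn_map M.

Lemma repD a b : M a -> M b -> s (a + b) = s a + s b.
Proof. by move=> Ma Mb; have := rep_linear hs 1 Ma Mb; rewrite !scale1r. Qed.

Lemma rep0 : s 0 = 0.
Proof.
by have := repD (vn0 M) (vn0 M); rewrite addr0 -{1}(addr0 (s 0)) => /addrI <-.
Qed.

Lemma repZ k a : M a -> s (k *: a) = k *: s a.
Proof.
by move=> Ma; have := rep_linear hs k Ma (vn0 M); rewrite rep0 !addr0.
Qed.

Lemma repN a : M a -> s (- a) = - s a.
Proof. by move=> Ma; rewrite -scaleN1r repZ // scaleN1r. Qed.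

Lemma repB a b : M a -> M b -> s (a - b) = s a - s b.
Proof. by move=> Ma Mb; rewrite repD ?repN //; exact: vn_opp. Qed.

Lemma rep_lin a : M a -> linear (s a).
Proof. by case/(rep_bounded hs). Qed.

Lemma rep_dot a x y : M a -> dot (s a x) y = dot x (s (adj a) y).
Proof. by move=> Ma; rewrite (rep_adj hs Ma) adjPr //; exact: (rep_bounded hs). Qed.

(** For [d > 0] the element [a + d] is the square of a self-adjoint [b] in [M], so
    [<h, s(a + d) h> = |s(b) h|^2]. The value of [d] is such that [d |h|^2 <= e]. *)
Lemma rep_pos a : M a -> selfadj a -> (forall x, 0 <= complex.Re (dot x (a x))) ->
  forall h, 0 <= complex.Re (dot h (s a h)).
Proof.
move=> Ma sa pa h; apply/ler_addgt0Pr => e e0; rewrite addrC.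
pose d := e / (nrm h ^+ 2 + 1).
have n0 : 0 < nrm h ^+ 2 + 1 by rewrite ltr_wpDl ?sqr_ge0.
have d0 : 0 < d by rewrite divr_gt0.
pose c := d%:C *: id + a.
have Mc : M c by apply: vn_lin => //; exact: vn_id.
have sc : selfadj c.
  move=> x y; rewrite /c !fctE dotDl dotD dotZl dotZ sa (_ : Num.conj _ = d%:C) //.
  by apply: CrealP; rewrite complex_real.
have [|b [b' [Mb _ sb bE _]]] := vn_sqrt Mc sc d0.
  by move=> x; rewrite /c !fctE dotD dotZ cReD cReZ Re_dotxx lerDl.
have := sqr_ge0 (nrm (s b h)); rewrite -Re_dotxx rep_dot // selfadj_adj //.
rewrite -[s b (s b h)]/((s b \o s b) h) -(rep_comp hs) // bE.
rewrite (rep_linear hs) ?(rep_id hs) //; last exact: vn_id.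
rewrite !fctE dotD dotZ cReD cReZ Re_dotxx => /le_trans; apply.
rewrite lerD2r /d mulrAC ler_pdivrMr // ler_pM2l // lerDl //.
Qed.

(** Positivity of [s] applied to [|a|^2 - adj a \o a]. *)
Lemma rep_contr a h : M a -> nrm (s a h) <= opnorm a * nrm h.
Proof.
move=> Ma; have ba := vn_bounded Ma; have o0 := opnorm_ge0 ba.
pose c := (opnorm a ^+ 2)%:C *: id - (adj a \o a).
have Maa : M (adj a \o a) by apply: vn_comp => //; exact: vn_adj.
have Mc : M c by apply: vn_sub => //; apply: vn_scale; exact: vn_id.
have sc : selfadj c.
  move=> x y; rewrite /c !fctE dotBl dotB dotZl dotZ (_ : Num.conj _ = (opnorm a ^+ 2)%:C) /=.
    by rewrite adjPr // -adjP // adjK.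
  by apply: CrealP; rewrite complex_real.
have := rep_pos Mc sc _ h.
rewrite repB //; last by apply: vn_scale; exact: vn_id.
rewrite repZ; last exact: vn_id.
rewrite (rep_id hs) (rep_comp hs) //; last exact: vn_adj.
rewrite !fctE dotB dotZ cReB cReZ /= -rep_dot // !Re_dotxx subr_ge0 -exprMn.
rewrite ler_pXn2r ?nnegrE ?mulr_ge0 ?nrm_ge0 //; apply.
move=> x; rewrite /c !fctE dotB dotZ cReB cReZ /= adjPr // !Re_dotxx subr_ge0 -exprMn.
by rewrite ler_pXn2r ?nnegrE ?mulr_ge0 ?nrm_ge0 // opnorm_le.
Qed.

(** Normality at [0] bounds the functional by [1] where finitely many ultraweak functionals are
    small. On their common kernel, scaling makes it vanish, so it is a linear combination of them on
    [M]. *)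
Lemma rep_predual (h k : H) : predual (M : set _) (fun a => dot h (s a k)).
Proof.
have lM : forall a, (M : set _) a -> linear a by move=> a /vn_linear.
have Ml : forall (z : R[i]) a b, (M : set _) a -> (M : set _) b -> (M : set _) (z *: a + b).
  by move=> c a b; exact: vn_lin.
have hb : predual (@bounded_op R H H) (fun A => dot h (A k)) by exact: predual_vec.
have [n [w [d [pw d0 hw]]]] := rep_normal hs hb (vn0 M) ltr01.
have lf : linear_on (M : set _) (fun a => dot h (s a k)).
  by move=> c a b Ma Mb; rewrite (rep_linear hs) // !fctE dotD dotZ.
have lw i : linear_on (M : set _) (w i) by apply: predual_linear_on.
have [|c hc] := span_functionals Ml lw lf.
  move=> a Ma wa; apply: nrm_eq0; apply/eqP; rewrite eq_le nrm_ge0 andbT.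
  apply/ler_addgt0Pr => e e0; rewrite add0r.
  (* The functionals vanish at every multiple of [a]; the bound [1] at [a / e] is the bound [e] at
     [a]. *)
  have := hw (e^-1%:C *: a) (vn_scale _ Ma).
  rewrite rep0 dot0 subr0 repZ // dotZ nrmM nrm_real ger0_norm ?invr_ge0 ?(ltW e0) //.
  rewrite ltr_pdivrMl // mulr1 => /(_ _)/ltW; apply => i.
  have := lw i e^-1%:C a 0 Ma (vn0 M); rewrite addr0 wa mulr0 add0r => ->.
  by rewrite subrr nrm0.
apply: predual_on (predual_sum c lM pw) => a Ma.
by rewrite -hc.
Qed.

End NormalRep.

(** * Hilbert modules and sigma-dense submodules *)

Section Module.
Variables (R : realType) (M : vnalg R) (E : hmod M).
Implicit Types x y z : E.

Lemma ipD x y z : ip x (y + z) = ip x y + ip x z.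
Proof. exact: (linD (ip_linear x)). Qed.

Lemma ip0r x : ip x 0 = 0.
Proof. exact: (lin0 (ip_linear x)). Qed.

Lemma ip_linl x y z (k : R[i]) : ip (k *: x + y) z = Num.conj k *: ip x z + ip y z.
Proof.
rewrite (ip_adj z) ip_linear adj_lin; last first.
- exact/vn_bounded/ip_in.
- exact/vn_bounded/ip_in.
by rewrite -!ip_adj.
Qed.

Lemma ip_ractl x y a : M a -> ip (ract x a) y = adj a \o ip x y.
Proof.
move=> Ma; rewrite (ip_adj y) ip_ract // adj_comp -?ip_adj //.
- exact/vn_bounded/ip_in.
- exact: vn_bounded.
Qed.

Lemma ip_selfadj x : selfadj (ip x x).
Proof.
by move=> u v; rewrite -(adjPr (vn_bounded (ip_in x x))) -ip_adj.
Qed.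

Lemma ip_positive x : positive_op (ip x x).
Proof.
split; [exact/vn_bounded/ip_in|exact: ip_selfadj|move=> h].
by have := ip_ge0 x h; rewrite (selfadj_Re _ (@ip_selfadj x)) ler0c.
Qed.

End Module.

Section RepForm.
Variables (R : realType) (M : vnalg R) (E : hmod M) (H : hilbert R).
Variables (s : vn_map M -> H -> H) (hs : normal_rep s).
Implicit Types (x y z w : E) (h k : H).

Definition hform h x y : R[i] := dot h (s (ip x y) h).
Definition hq h x : R := psd_q (hform h) x.

Lemma rep_ip x y h k : dot (s (ip x y) h) k = dot h (s (ip y x) k).
Proof. by rewrite (rep_dot hs) -?ip_adj //; exact: ip_in. Qed.

Lemma hform_psd h : psd_form (hform h).
Proof.
have cj x y : hform h y x = Num.conj (hform h x y).
  by rewrite /hform -dot_conj rep_ip.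
split=> // [x k y z|x].
  rewrite /hform ip_linear (rep_linear hs) ?fctE ?dotD ?dotZ //; exact: ip_in.
rewrite -[hform h x x]RRe_real; last by apply/CrealP; rewrite -cj.
rewrite ler0c; apply: (rep_pos hs); [exact: ip_in|exact: ip_selfadj|].
by have [] := ip_positive x.
Qed.

Lemma rep_ip_ract x y a h : M a -> s (ip x (ract y a)) h = s (ip x y) (s a h).
Proof. by move=> Ma; rewrite ip_ract // (rep_comp hs (ip_in x y) Ma). Qed.

Lemma dot_rep_ractl x y a h k : M a ->
  dot k (s (ip (ract x a) y) h) = dot (s a k) (s (ip x y) h).
Proof.
move=> Ma; rewrite ip_ractl // (rep_comp hs (vn_adj Ma) (ip_in x y)) /=.
by rewrite -(rep_dot hs).
Qed.

(** Positivity of the form at [z a - |z|^2 w] with [a = <z, w>], where the square of [z a] is at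
    most [|z|^2 |s(a) h|^2]. This is what turns convergence in the seminorm into norm convergence in
    [H]. *)
Lemma module_CS z w h : nrm (s (ip z w) h) ^+ 2 <= nrm z ^+ 2 * hq h w.
Proof.
pose a := ip z w; have Ma : M a by exact: ip_in.
have Maa : M (adj a) by exact: vn_adj.
have [z0|z0] := eqVneq (nrm z) 0.
  rewrite (nrm_eq0 z0) (_ : ip 0 w = 0) ?(rep0 hs) ?nrm0 ?expr0n ?mul0r //.
  by have := ip_linl z z w (-1); rewrite scaleN1r addNr rmorphN1 scaleN1r addNr.
pose N := nrm z ^+ 2; have N0 : 0 < N by rewrite exprn_gt0 // lt_def z0 nrm_ge0.
have := psd_q_ge0 (hform_psd h) (ract z a + (- N)%:C *: w).
rewrite psd_qDZ; last exact: hform_psd.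
have -> : complex.Re (hform h (ract z a) w) = nrm (s a h) ^+ 2.
  by rewrite /hform dot_rep_ractl // Re_dotxx.
have : psd_q (hform h) (ract z a) <= N * nrm (s a h) ^+ 2.
  rewrite /psd_q /hform dot_rep_ractl // rep_ip_ract //.
  rewrite (le_trans (ler_norm _)) // (le_trans (Re_le_nrm _)) //.
  rewrite (le_trans (dot_CS _ _)) // expr2 mulrCA ler_wpM2l ?nrm_ge0 //.
  rewrite /N ip_norm; apply: (rep_contr hs); exact: ip_in.
rewrite -/(hq h w) -/N -/a; move: (nrm (s a h) ^+ 2) (hq h w) => A q; nra.
Qed.

(* [y = z b'] with [b] the square root of [<z,z> + e] and [b'] its inverse. *)
Lemma rescale z h (d : R) : 0 < d -> exists y b,
  [/\ M b, z = ract y b, nrm y <= 1 & nrm (s b h) ^+ 2 <= hq h z + d].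
Proof.
move=> d0; have n0 : 0 < nrm h ^+ 2 + 1 by rewrite ltr_wpDl ?sqr_ge0.
pose e := d / (nrm h ^+ 2 + 1); have e0 : 0 < e by rewrite divr_gt0.
pose c := e%:C *: id + ip z z.
have Mz : M (ip z z) by exact: ip_in.
have Mc : M c by apply: vn_lin => //; exact: vn_id.
have [bz sz pz] := ip_positive z.
have ce (x : vn_space M) : complex.Re (dot x (c x)) =
    e * nrm x ^+ 2 + complex.Re (dot x (ip z z x)).
  by rewrite /c !fctE dotD dotZ cReD cReZ Re_dotxx.
have [||b [b' [Mb Mb' sb bE [bb' b'b]]]] := @vn_sqrt _ _ c e Mc _ e0.
- move=> x y; rewrite /c !fctE dotDl dotD dotZl dotZ sz (_ : Num.conj _ = e%:C) //.
  by apply: CrealP; rewrite complex_real.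
- by move=> x; rewrite ce lerDl.
have bb'K (v : vn_space M) : b (b' v) = v by rewrite -[LHS]/((b \o b') v) bb'.
exists (ract z b'), b; split=> //.
- by rewrite -ract_comp // b'b ract_id.
- rewrite -(@ler_pXn2r _ 2) ?nnegrE ?nrm_ge0 // ip_norm expr1n.
  apply: opnorm_ub => // x; apply: (positive_norm ler01 (ip_positive _)) => {}x.
  rewrite mul1r ip_ract // ip_ractl //= adjPr; last exact: vn_bounded.
  have : complex.Re (dot (b' x) (c (b' x))) = nrm x ^+ 2.
    by rewrite -bE /= bb'K -sb bb'K Re_dotxx.
  by rewrite ce => <-; rewrite lerDr mulr_ge0 ?sqr_ge0 // ltW.
- rewrite -Re_dotxx (rep_dot hs) // selfadj_adj //.
  rewrite -[s b (s b h)]/((s b \o s b) h) -(rep_comp hs) // bE /c.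
  rewrite (rep_linear hs) ?(rep_id hs) //; last exact: vn_id.
  rewrite !fctE dotD dotZ cReD cReZ Re_dotxx addrC lerD2l.
  by rewrite /e mulrAC ler_pdivrMr // ler_pM2l // lerDl.
Qed.

Lemma fun_norm_vec h k : 0 <= fun_norm (fun a : vn_map M => dot h (s a k)) <= nrm h * nrm k.
Proof.
have hub a : M a /\ opnorm a <= 1 -> nrm (dot h (s a k)) <= nrm h * nrm k.
  move=> [Ma a1]; rewrite (le_trans (dot_CS _ _)) // ler_wpM2l ?nrm_ge0 //.
  by rewrite (le_trans (rep_contr hs _ Ma)) // ler_piMl ?nrm_ge0.
have M0 : M (0 : vn_map M) /\ opnorm (0 : vn_map M) <= 1.
  by split; [exact: vn0|apply: opnorm_ub => // x; rewrite nrm0 mul1r nrm_ge0].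
apply/andP; split.
  apply: (le_trans (nrm_ge0 (dot h (s 0 k)))); apply: ub_le_sup.
    by exists (nrm h * nrm k) => _ [a /= Ma <-]; exact: hub.
  by exists 0.
apply: ge_sup; first by exists (nrm (dot h (s 0 k))), 0.
by move=> _ [a /= Ma <-]; exact: hub.
Qed.

End RepForm.
Arguments hform_psd {R M E H s} hs h.

(** * Sigma-density and the seminorms given by a representation *)

Section Density.
Variables (R : realType) (M : vnalg R) (E : hmod M) (H : hilbert R).
Variables (s : vn_map M -> H -> H) (hs : normal_rep s).
Implicit Types (x y z w : E) (h k : H).

Lemma hq_ge0 h x : 0 <= hq s h x.
Proof. exact/psd_q_ge0/hform_psd. Qed.

Lemma hqD_le h x y : hq s h (x + y) <= 2 * hq s h x + 2 * hq s h y.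
Proof.
have := psd_par (hform_psd hs h) x y; rewrite -!/(hq s h _).
by have := hq_ge0 h (x - y); lra.
Qed.

Lemma hqBC h x y : hq s h (x - y) = hq s h (y - x).
Proof.
have := psd_qZ (hform_psd hs h) (-1) (y - x).
rewrite scaleN1r opprB -!/(hq s h _) => ->.
by rewrite (_ : -1 = (-1)%:C) ?nrm_real ?normrN1 ?expr1n ?mul1r // rmorphN1.
Qed.

Lemma expn16_cvg : (fun n => 16 ^ n)%N @ \oo --> \oo.
Proof.
move=> A [N _ hN]; exists N => // n /= Nn; apply: hN => /=.
by rewrite (leq_trans Nn) // ltnW // ltn_expl.
Qed.

(* The difference of a minimizing sequence with its limit defines a functional,
   which is a norm convergent sum of elementary functionals after the
   factorizations of [rescale]. *)
Lemma cauchy_sigma_fun h (v : nat -> E) :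
  (forall m n, (m <= n)%N -> hq s h (v n - v m) <= 4 * m.+1%:R^-1) ->
  exists2 f, sigma_fun f &
    forall x, (fun n => hform s h (v n) x : R[i]^o) @ \oo --> (f x : R[i]^o).
Proof.
move=> vC; have hp : psd_form (@hform _ _ E _ s h) by exact: hform_psd.
have /choice[f hf] : forall x, exists l : R[i], (fun n => hform s h (v n) x : R[i]^o) @ \oo --> (l : R[i]^o).
  move=> x; have [||l hl] := @cauchy_nrm _ _ (fun n => s (ip x (v n)) h)
    (fun n => nrm x * (2 * Num.sqrt n.+1%:R^-1)).
  - move=> m n mn; rewrite -(@ler_pXn2r _ 2) ?nnegrE ?mulr_ge0 ?nrm_ge0 ?sqrtr_ge0 //.
    rewrite !exprMn sqr_sqrtr ?invr_ge0 // -natrX.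
    rewrite -[X in nrm X](_ : s (ip x (v n - v m)) h = _).
      apply: (le_trans (module_CS hs _ _ _)).
      by rewrite ler_wpM2l ?sqr_ge0 // vC.
    rewrite (linB (ip_linear x)) (repB hs) //; exact: ip_in.
  - by rewrite -(mulr0 (nrm x)); apply: cvgMr; exact: cvg_double_sqrt_harmonic.
  exists (dot l h); apply: cvgn_ext (cvg_dotl h hl) => n.
  by rewrite (rep_ip hs).
exists f => //.
(* Along this subsequence squared increments decay like [16^-n], so the functionals they define have
   norms decaying like [4^-n] and are summable. *)
pose phi n := (16 ^ n)%N.
pose u n := v (phi n).
pose dl n := if n is k.+1 then u k.+1 - u k else u 0%N.
(* The increment from [u n] to [u (n+1)] has square at most [4 * 16^-n], which is [64 * 16^-(n+1)];
   the other summand accounts for the initial term. *)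
pose C := hq s h (u 0%N) + 64.
have C0 : 0 <= C by rewrite addr_ge0 ?hq_ge0.
have i16 n : 0 < 16^-1 ^+ n :> R by rewrite exprn_gt0 ?invr_gt0.
have hdl n : hq s h (dl n) <= C * 16^-1 ^+ n.
  case: n => [|n] /=; first by rewrite expr0 mulr1 lerDl.
  have le16 : (16 ^ n <= 16 ^ n.+1)%N by rewrite leq_exp2l.
  apply: (le_trans (vC _ _ le16)).
  have h1 : (phi n).+1%:R^-1 <= 16^-1 ^+ n :> R.
    rewrite exprVn lef_pV2 ?posrE ?ltr0n ?exprn_gt0 // /phi -natrX ler_nat.
    exact: leqnSn.
  apply: (@le_trans _ _ (4 * 16^-1 ^+ n)); first by rewrite ler_pM2l.
  rewrite exprS mulrA ler_pM2r //.
  have := hq_ge0 h (u 0%N); rewrite /C; lra.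
have /choice[yb hyb] : forall n, exists yb : E * vn_map M,
    [/\ M yb.2, dl n = ract yb.1 yb.2, nrm yb.1 <= 1 &
        nrm (s yb.2 h) ^+ 2 <= hq s h (dl n) + 16^-1 ^+ n].
  by move=> n; have [y [b hb]] := rescale hs (dl n) h (i16 n); exists (y, b).
pose y n := (yb n).1; pose b n := (yb n).2.
pose w n (a : vn_map M) := dot (s (b n) h) (s a h).
have wE n x : w n (ip (y n) x) = hform s h (dl n) x.
  have [Mb -> _ _] := hyb n.
  by rewrite /hform (dot_rep_ractl hs).
have hw n := fun_norm_vec hs (s (b n) h) h.
exists w, y; split.
- by move=> n; exact: (rep_predual hs).
- pose g := geometric (Num.sqrt (C + 1) * nrm h) (4^-1 : R).
  have cg : cvgn (series g).
    apply: is_cvg_geometric_series; rewrite ger0_norm ?invr_ge0 //.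
    by rewrite invf_lt1 // ltr1n.
  apply: (series_le_cvg _ _ _ cg).
  + by move=> n; have /andP[h1 _] := hw n; rewrite mulr_ge0 ?nrm_ge0.
  + by move=> n; rewrite /g /= !mulr_ge0 ?sqrtr_ge0 ?nrm_ge0 ?exprn_ge0 ?invr_ge0.
  + move=> n; have /andP[h0 h1] := hw n; have [Mb _ y1 b2] := hyb n.
    apply: (@le_trans _ _ (fun_norm (w n))); first by rewrite ler_piMr.
    apply: (le_trans h1); rewrite /g /= mulrAC ler_wpM2r ?nrm_ge0 //.
    rewrite -(@ler_pXn2r _ 2) ?nnegrE ?mulr_ge0 ?nrm_ge0 ?sqrtr_ge0 ?exprn_ge0 ?invr_ge0 //.
    rewrite exprMn sqr_sqrtr ?addr_ge0 ?hq_ge0 // exprAC.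
    rewrite (_ : 4^-1 ^+ 2 = 16^-1); last by rewrite exprVn -natrX.
    by apply: (le_trans b2); rewrite mulrDl mul1r lerD2r hdl.
- move=> x.
  have hser n : series (fun n => w n (ip (y n) x) : R[i]^o) n.+1 = hform s h (u n) x.
    elim: n => [|n IH]; first by rewrite seriesSr /series /= big_geq // add0r wE.
    by rewrite seriesSr IH wE /= (psdBl hp) addrC subrK.
  have h1 : (fun n => hform s h (u n) x : R[i]^o) @ \oo --> (f x : R[i]^o).
    exact: (cvg_comp _ _ expn16_cvg (hf x)).
  have h2 : (fun n => series (fun n => w n (ip (y n) x) : R[i]^o) n.+1) @ \oo --> (f x : R[i]^o).
    by apply: cvgn_ext h1 => n; rewrite hser.
  by have := @cvg_shiftS _ (series (fun n => w n (ip (y n) x) : R[i]^o)) (nbhs (f x : R[i]^o)); move=> /propeqP[/(_ h2)].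
Qed.

(** For a minimizing sequence [u], the functionals [<z - u n, .>] converge to some [f] that is
    sigma-continuous and vanishes on [S], hence at [z]. Then [q(z - u n)], the difference of
    [<z - u n, z>] and [<z - u n, u n>], tends to [0]: the first term tends to [f z], the second is
    small by near-minimality. *)
Lemma weak_dense_approx (S : set E) h z :
  S 0 -> (forall a x y, S x -> S y -> S (a *: x + y)) ->
  weak_dense (@sigma_fun _ _ E) S ->
  forall e : R, 0 < e -> exists2 x, S x & hq s h (z - x) < e.
Proof.
move=> S0 lS dS; have hp : psd_form (@hform _ _ E _ s h) by exact: hform_psd.
have [|u [Su uC ug]] := minimizing_sequence hp S0 lS (psd_linear hp z).
  exists (- hq s h z) => x Sx; have := hq_ge0 h (x + (-1)%:C *: z).
  rewrite /hq psd_qDZ // sqrrN expr1n mul1r.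
  rewrite (psd_conj hp z x) cRe_conj; lra.
have [|f fs hf] := @cauchy_sigma_fun h (fun n => z - u n).
  move=> m n mn; have -> : z - u n - (z - u m) = u m - u n.
    by rewrite opprB addrC addrA subrK.
  by rewrite hqBC; exact: uC.
have f0 x : S x -> f x = 0.
  move=> Sx; suff h0 : (fun n => hform s h (z - u n) x : R[i]^o) @ \oo --> (0 : R[i]^o).
    exact: (cvg_unique _ (hf x) h0).
  apply: (@cvg_nrm_le _ _ _ _ (fun n => Num.sqrt n.+1%:R^-1 * Num.sqrt (hq s h x))).
    move=> n; rewrite subr0 -(@ler_pXn2r _ 2) ?nnegrE ?mulr_ge0 ?nrm_ge0 ?sqrtr_ge0 //.
    rewrite exprMn !sqr_sqrtr ?invr_ge0 ?hq_ge0 //.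
    have := ug n x Sx; rewrite nrmBC.
    by rewrite (psdBl hp).
  by rewrite -(mul0r (Num.sqrt (hq s h x))); apply: cvgMl; exact: cvg_sqrt_harmonic.
have fz : f z = 0.
  apply: nrm_eq0; apply/eqP; rewrite eq_le nrm_ge0 andbT.
  apply/ler_addgt0Pr => e e0; rewrite add0r.
  have [x Sx /(_ ord0)] := dS z e e0 1%N (fun=> f) (fun=> fs).
  by rewrite f0 // sub0r nrmN => /ltW.
(* The sequence is bounded: [q(u n) <= 2 q(u 0) + 2 q(u n - u 0)], with the last square at most
   [4]. *)
pose B := 2 * hq s h (u 0%N) + 8.
have B0 : 0 <= B by rewrite addr_ge0 ?mulr_ge0 ?hq_ge0.
have uB n : hq s h (u n) <= B.
  have := hqD_le h (u 0%N) (u n - u 0%N); rewrite addrC subrK.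
  by have := uC 0%N n isT; rewrite invr1 -/(hq s h _) /B; lra.
have h0 : (fun n => nrm (hform s h (z - u n) z) + Num.sqrt n.+1%:R^-1 * Num.sqrt B) @ \oo --> (0 : R).
  have h1 := cvg_nrm (hf z); rewrite fz nrm0 in h1.
  rewrite -[X in _ --> X]addr0; apply: cvgD => //.
  by rewrite -(mul0r (Num.sqrt B)); apply: cvgMl; exact: cvg_sqrt_harmonic.
move=> e e0; move/cvgrPdist_lt : h0 => /(_ _ e0) [N _ /(_ N (leqnn N))].
move=> {}h0; exists (u N) => //; apply: le_lt_trans h0; rewrite sub0r normrN.
apply: le_trans (ler_norm _); move: N => n.
rewrite {1}/hq /psd_q (psdB hp _ z) cReB lerD //.
  by rewrite (le_trans (ler_norm _)) // Re_le_nrm.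
rewrite (@le_trans _ _ (nrm (hform s h (z - u n) (u n)))) //.
  by rewrite -cReN (le_trans (ler_norm _)) // (le_trans (Re_le_nrm _)) // nrmN.
rewrite -(@ler_pXn2r _ 2) ?nnegrE ?mulr_ge0 ?nrm_ge0 ?sqrtr_ge0 //.
rewrite exprMn !sqr_sqrtr ?invr_ge0 //.
have := ug n (u n) (Su n); rewrite nrmBC -(psdBl hp) => /le_trans; apply.
by rewrite ler_wpM2l ?invr_ge0 // uB.
Qed.

End Density.

(** * Tensor powers and the Fock space *)

Section Subspace.
Variable R : realType.

Definition closed_subspace (K : hilbert R) (C : set K) :=
  [/\ closed C, C 0 & forall (a : R[i]) x y, C x -> C y -> C (a *: x + y)].

Lemma closed_seqP (V : normedModType R[i]) (C : set V) :
  (forall (u : nat -> V) (l : V), (forall n, C (u n)) -> u @ \oo --> l -> C l) -> closed C.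
Proof. by move=> h l /closureP[u Cu ul]; apply: h ul. Qed.

Section Tensor.
Variables (X Y : lmodType R[i]) (Z : lmodType R[i]) (t : X -> Y -> Z).
Hypothesis tl : forall y, linear (t^~ y).

Lemma tensor_span0 : tensor_span t 0.
Proof.
exists 0%N, (fun=> 0), (fun=> 0).
by rewrite big_ord0.
Qed.

Lemma tensor_span1 x y : tensor_span t (t x y).
Proof. by exists 1%N, (fun=> x), (fun=> y); rewrite big_ord1. Qed.

Lemma tensor_span_lin (a : R[i]) u v :
  tensor_span t u -> tensor_span t v -> tensor_span t (a *: u + v).
Proof.
move=> [m [x [y ->]]] [n [x' [y' ->]]].
exists (m + n)%N, (fun i : 'I_(m + n) => match fintype.split i with inl j => a *: x j | inr j => x' j end),
  (fun i : 'I_(m + n) => match fintype.split i with inl j => y j | inr j => y' j end).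
rewrite big_split_ord /= scaler_sumr; congr (_ + _); apply: eq_bigr => i _.
  rewrite (_ : fintype.split _ = inl i); last exact: (unsplitK (inl i)).
  by rewrite [RHS](linZ (tl (y i))).
by rewrite (_ : fintype.split _ = inr i) //; exact: (unsplitK (inr i)).
Qed.

End Tensor.

Lemma closure_span_subspace (X Y : lmodType R[i]) (K : hilbert R) (t : X -> Y -> K) :
  (forall y, linear (t^~ y)) -> closed_subspace (closure (tensor_span t)).
Proof.
move=> tl; split; first exact: closed_closure.
  by apply: subset_closure; exact: tensor_span0.
move=> a u v /closureP[x hx xu] /closureP[y hy yv]; apply/closureP.
exists (fun n => a *: x n + y n); first by move=> n; apply: tensor_span_lin.
by apply: cvgD => //; apply: cvgZl_tmp.
Qed.

Section ClosedSubspace.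
Variables (K : hilbert R) (C : set K).
Hypothesis hC : closed_subspace C.

Lemma subspaceD x y : C x -> C y -> C (x + y).
Proof. by case: hC => _ C0 Cl Cx Cy; rewrite -(scale1r x); apply: Cl. Qed.

Lemma subspace_sum n (x : 'I_n -> K) : (forall i, C (x i)) -> C (\sum_i x i).
Proof.
move=> Cx; elim/big_ind: _ => //; first by case: hC.
exact: subspaceD.
Qed.

Lemma subspace_limit (u : nat -> K) (l : K) : (forall n, C (u n)) -> u @ \oo --> l -> C l.
Proof. by case: hC => cC _ _; exact: closed_seq. Qed.

Lemma closure_span_sub (X Y : lmodType R[i]) (t : X -> Y -> K) :
  (forall x y, C (t x y)) -> closure (tensor_span t) `<=` C.
Proof.
move=> Ct l /closureP[u hu ul]; apply: subspace_limit ul => n.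
by have [m [x [y ->]]] := hu n; apply: subspace_sum.
Qed.

End ClosedSubspace.

Lemma preimage_subspace (H K : hilbert R) (A : H -> K) (C : set K) :
  bounded_op A -> closed_subspace C -> closed_subspace [set x | C (A x)].
Proof.
move=> bA [cC C0 Cl]; split.
- by apply: closed_seqP => u l Cu ul; apply: (closed_seq cC Cu (bounded_cvg bA ul)).
- by rewrite /= (lin0 bA.1).
- by move=> a x y /= Cx Cy; rewrite bA.1; apply: Cl.
Qed.

Lemma orth_subspace (K : hilbert R) (k : K) : closed_subspace [set x | dot k x = 0].
Proof.
split=> [||a x y /= Cx Cy]; last by rewrite dotD dotZ Cx Cy mulr0 addr0.
  apply: closed_seqP => u l Cu ul /=.
  have h1 := cvg_dotr k ul.
  have h2 : (fun n => dot k (u n) : R[i]^o) @ \oo --> (0 : R[i]^o).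
    by apply: (@cvgn_ext _ (fun=> 0)) => [n|]; [rewrite Cu|exact: cvg_cst].
  exact: (cvg_unique _ h1 h2).
by rewrite /= dot0.
Qed.

Lemma orthl_subspace (K : hilbert R) (k : K) : closed_subspace [set x | dot x k = 0].
Proof.
rewrite (_ : [set x | _] = [set x | dot k x = 0]); first exact: orth_subspace.
apply/seteqP; split=> x /= h; first by rewrite dot_conj h rmorph0.
by rewrite dot_conj h rmorph0.
Qed.

(** The three values make [|x - y|^2] zero. Linearity and intertwining relations are obtained this
    way from inner products alone. *)
Lemma dot_eq (K : hilbert R) (x y : K) (q : R[i]) :
  dot x x = q -> dot x y = q -> dot y y = q -> x = y.
Proof.
move=> xx xy yy; apply/eqP; rewrite -subr_eq0; apply/eqP/dot_eq0.
rewrite dotBl !dotB [dot y x]dot_conj xx xy yy -{3}xx -(dot_conj x x) xx.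
by rewrite !subrr.
Qed.

Lemma cvg_dot (K : hilbert R) (u v : nat -> K) (k l : K) :
  u @ \oo --> k -> v @ \oo --> l ->
  (fun n => dot (u n) (v n) : R[i]^o) @ \oo --> (dot k l : R[i]^o).
Proof.
move=> uk vl.
apply: (@cvg_nrm_le _ _ _ _ (fun n => nrm (u n - k) * nrm (v n) + nrm k * nrm (v n - l))).
  move=> n; rewrite (_ : _ - _ = dot (u n - k) (v n) + dot k (v n - l)).
    by rewrite (le_trans (nrmD _ _)) // lerD // dot_CS.
  by rewrite dotBl dotB addrA subrK.
rewrite [X in _ --> X](_ : 0 = 0 * nrm l + nrm k * 0); last by rewrite mul0r mulr0 addr0.
apply: cvgD; apply: cvgM => //; [exact/cvg_nrm0P|exact: cvg_nrm|exact: cvg_cst|exact/cvg_nrm0P].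
Qed.

End Subspace.

Section Gram.
Variables (R : realType) (M : vnalg R) (E : hmod M) (H K : hilbert R).
Variables (s : vn_map M -> H -> H) (hs : normal_rep s).

(** An isometry of [E (x)_s H] into [K], described on elementary tensors; its bilinearity is a
    consequence, proved next. *)
Definition gram (t : E -> H -> K) := forall x h y k,
  dot (t x h) (t y k) = dot h (s (ip x y) k).

Lemma gram_linl t : gram t -> forall h, linear (t^~ h).
Proof.
move=> gt h a x y; pose q := dot h (s (ip (a *: x + y) (a *: x + y)) h).
have sl u v w : dot h (s (ip u (a *: v + w)) h) =
    a * dot h (s (ip u v) h) + dot h (s (ip u w) h).
  rewrite ip_linear (rep_linear hs) ?fctE ?dotD ?dotZ //; exact: ip_in.
have sr u v w : dot h (s (ip (a *: v + w) u) h) =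
    Num.conj a * dot h (s (ip v u) h) + dot h (s (ip w u) h).
  by rewrite -(rep_ip hs) dot_conj sl rmorphD rmorphM /= -!(dot_conj h) !(rep_ip hs).
apply: (@dot_eq _ _ _ _ q).
- by rewrite gt.
- by rewrite dotD dotZ !gt /q sl.
- by rewrite dotDl dotZl !dotD !dotZ !gt /q sr !sl.
Qed.

Lemma gram_linr t : gram t -> forall x, linear (t x).
Proof.
move=> gt x a h k; have lx : linear (s (ip x x)) by apply: (rep_lin hs); exact: ip_in.
apply: (@dot_eq _ _ _ _ (dot (a *: h + k) (s (ip x x) (a *: h + k)))).
- by rewrite gt.
- by rewrite dotD dotZ !gt -dotZ -dotD -lx.
by rewrite dotDl dotZl !dotD !dotZ !gt dotDl dotZl lx !dotD !dotZ.
Qed.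

End Gram.

(** * Extension of an isometry from a sigma-dense span of tensors *)

Section TensorStep.
Variables (R : realType) (M : vnalg R) (E1 E2 G : wcorr M) (tau : E1 -> E2 -> G).
Hypothesis htau : is_tensor tau.
Variables (H K : hilbert R) (s : vn_map M -> H -> H) (hs : normal_rep s).
Variables (p : vn_map M -> K -> K) (hp : normal_rep p).
Variables (V : E1 -> K -> K).
Hypothesis Vlin : forall k, linear (V^~ k).
Hypothesis Vdot : forall x y k l, dot (V x k) (V y l) = dot k (p (ip x y) l).
Hypothesis Vlact : forall a x k, M a -> p a (V x k) = V (lact a x) k.
Variables (t2 : E2 -> H -> K) (gt2 : gram s t2).
Hypothesis t2lact : forall a y h, M a -> p a (t2 y h) = t2 (lact a y) h.

(** A relation, since [z] has many expressions as a sum of tensors; [rel_dot] shows that inner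
    products of the vectors [k] depend only on [z] and [h]. *)
Let rel (z : G) h k := exists n (x : 'I_n -> E1) (y : 'I_n -> E2),
  z = \sum_i tau (x i) (y i) /\ k = \sum_i V (x i) (t2 (y i) h).

Let rel_lin a z1 z2 h k1 k2 : rel z1 h k1 -> rel z2 h k2 ->
  rel (a *: z1 + z2) h (a *: k1 + k2).
Proof.
move=> [m [x [y [-> ->]]]] [n [x' [y' [-> ->]]]].
exists (m + n)%N, (fun i : 'I_(m + n) => match fintype.split i with inl j => a *: x j | inr j => x' j end),
  (fun i : 'I_(m + n) => match fintype.split i with inl j => y j | inr j => y' j end).
rewrite !big_split_ord /= !scaler_sumr; split; congr (_ + _); apply: eq_bigr => i _.
- rewrite (_ : fintype.split _ = inl i); last exact: (unsplitK (inl i)).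
  by rewrite [RHS](linZ (tensor_linearl htau (y i))).
- by rewrite (_ : fintype.split _ = inr i) //; exact: (unsplitK (inr i)).
- rewrite (_ : fintype.split _ = inl i); last exact: (unsplitK (inl i)).
  by rewrite [RHS](linZ (Vlin _)).
- by rewrite (_ : fintype.split _ = inr i) //; exact: (unsplitK (inr i)).
Qed.

Let sip_sumr n (z : G) (y : 'I_n -> G) h k :
  dot h (s (ip z (\sum_i y i)) k) = \sum_i dot h (s (ip z (y i)) k).
Proof.
apply: (big_morph (fun y => dot h (s (ip z y) k))) => [u v|].
  rewrite ipD (repD hs) ?fctE ?dotD //; exact: ip_in.
by rewrite (lin0 (ip_linear z)) (rep0 hs) dot0.
Qed.

Let sip_suml n (z : G) (y : 'I_n -> G) h k :
  dot h (s (ip (\sum_i y i) z) k) = \sum_i dot h (s (ip (y i) z) k).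
Proof.
rewrite -(rep_ip hs) dot_conj sip_sumr rmorph_sum; apply: eq_bigr => i _.
by rewrite /= -dot_conj (rep_ip hs).
Qed.

Let rel_dot z1 h1 k1 z2 h2 k2 : rel z1 h1 k1 -> rel z2 h2 k2 ->
  dot k1 k2 = dot h1 (s (ip z1 z2) h2).
Proof.
move=> [m [x [y [-> ->]]]] [n [x' [y' [-> ->]]]].
rewrite dot_suml sip_suml; apply: eq_bigr => i _.
rewrite dot_sum sip_sumr; apply: eq_bigr => j _.
by rewrite Vdot t2lact ?gt2 ?(tensor_ip htau) //; exact: ip_in.
Qed.

Let rel_lact a z h k : M a -> rel z h k -> rel (lact a z) h (p a k).
Proof.
move=> Ma [m [x [y [-> ->]]]]; have [la _ _ _] := lact_in G Ma.
exists m, (fun i => lact a (x i)), y; split.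
  by rewrite (lin_sum la); apply: eq_bigr => i _; rewrite (tensor_lact htau).
by rewrite (lin_sum (rep_lin hp Ma)); apply: eq_bigr => i _; rewrite Vlact.
Qed.

(** The approximating sequence depends on [h] as well as on [z], because the seminorm does; no
    single sequence has to serve all [h]. *)
Let approx (z : G) (h : H) (k : K) := exists (u : nat -> G) (kk : nat -> K),
  [/\ forall n, rel (u n) h (kk n), forall n, hq s h (z - u n) <= n.+1%:R^-1 & kk @ \oo --> k].

Let approx_ex z h : exists k, approx z h k.
Proof.
have tl := tensor_linearl htau.
have /choice[u hu] : forall n : nat, exists x, tensor_span tau x /\ hq s h (z - x) < n.+1%:R^-1.
  move=> n; have n0 : 0 < n.+1%:R^-1 :> R by rewrite invr_gt0 ltr0Sn.
  have [x Sx xn] := weak_dense_approx hs h z (tensor_span0 tau)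
    (fun a u v => tensor_span_lin tl a (u:=u) (v:=v)) (tensor_dense htau) n0.
  by exists x.
have /choice[kk hkk] : forall n, exists k, rel (u n) h k.
  move=> n; have [[m [x [y E]]] _] := hu n.
  by exists (\sum_i V (x i) (t2 (y i) h)), m, x, y.
have [||k hk] := @cauchy_nrm _ _ kk (fun n => 2 * Num.sqrt n.+1%:R^-1).
- move=> m n mn; rewrite -(@ler_pXn2r _ 2) ?nnegrE ?mulr_ge0 ?nrm_ge0 ?sqrtr_ge0 //.
  rewrite exprMn sqr_sqrtr ?invr_ge0 // -natrX -Re_dotxx.
  have r : rel (u n - u m) h (kk n - kk m).
    by rewrite addrC -scaleN1r [kk n - _]addrC -[- kk m]scaleN1r; apply: rel_lin.
  rewrite (rel_dot r r) -/(hform s h _ _) -/(psd_q _ _) -/(hq s h _).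
  have -> : u n - u m = (z - u m) + (-1) *: (z - u n).
    by rewrite scaleN1r opprB [RHS]addrC addrA subrK.
  apply: (le_trans (hqD_le hs h _ _)); rewrite scaleN1r opprB (hqBC hs h (u n)).
  have h1 := ltW (proj2 (hu m)); have h2 := ltW (proj2 (hu n)).
  have : n.+1%:R^-1 <= m.+1%:R^-1 :> R by rewrite lef_pV2 ?posrE // ler_nat.
  move: h1 h2; set e1 := n.+1%:R^-1; set e2 := m.+1%:R^-1; move: e1 e2 => e1 e2 *; lra.
- exact: cvg_double_sqrt_harmonic.
by exists k, u, kk; split=> // n; apply: ltW; case: (hu n).
Qed.

Let hq_cvg z h (u : nat -> G) w h' : (forall n, hq s h (z - u n) <= n.+1%:R^-1) ->
  (fun n => dot h' (s (ip w (u n)) h) : R[i]^o) @ \oo --> (dot h' (s (ip w z) h) : R[i]^o).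
Proof.
move=> hu; apply: (@cvg_nrm_le _ _ _ _ (fun n => nrm h' * (nrm w * Num.sqrt n.+1%:R^-1))).
  move=> n; rewrite nrmBC.
  have -> : dot h' (s (ip w z) h) - dot h' (s (ip w (u n)) h) = dot h' (s (ip w (z - u n)) h).
    rewrite -dotB (linB (ip_linear w)) (repB hs) //; exact: ip_in.
  rewrite (le_trans (dot_CS _ _)) // ler_wpM2l ?nrm_ge0 //.
  rewrite -(@ler_pXn2r _ 2) ?nnegrE ?mulr_ge0 ?nrm_ge0 ?sqrtr_ge0 //.
  rewrite exprMn sqr_sqrtr ?invr_ge0 // (le_trans (module_CS hs _ _ _)) //.
  by rewrite ler_wpM2l ?sqr_ge0.
rewrite -(mulr0 (nrm h')); apply: cvgMr; rewrite -(mulr0 (nrm w)); apply: cvgMr.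
exact: cvg_sqrt_harmonic.
Qed.

(** The limit [t3 z h] is picked separately for each pair. The inner products [d1] and [d2] can be
    computed whatever the choice, and [dot_eq] turns them into the identities. The clause on closed
    subspaces stands in for norm density: it lets properties of the vectors [V x (t2 y h)] pass to
    all values of [t3]. *)
Lemma tensor_step : exists t3 : G -> H -> K,
  [/\ gram s t3, forall a z h, M a -> p a (t3 z h) = t3 (lact a z) h,
      forall x y h, t3 (tau x y) h = V x (t2 y h) &
      forall (C : set K) h, closed_subspace C -> (forall x y, C (V x (t2 y h))) ->
        forall z, C (t3 z h)].
Proof.
have /choice[t0 ht0] : forall zh : G * H, exists k, approx zh.1 zh.2 k.
  by move=> [z h]; exact: approx_ex.
pose t3 z h := t0 (z, h).
have ht z h : approx z h (t3 z h) by exact: (ht0 (z, h)).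
have d1 z1 h1 k1 z h : rel z1 h1 k1 -> dot k1 (t3 z h) = dot h1 (s (ip z1 z) h).
  move=> r1; have [u [kk [ru hu kt]]] := ht z h.
  have c1 := cvg_dotr k1 kt; have c2 := hq_cvg (w := z1) (h' := h1) hu.
  apply: (cvgn_lim_eq c1 c2) => n.
  by rewrite (rel_dot r1 (ru n)).
have gt : gram s t3.
  move=> z1 h1 z h; have [u [kk [ru hu kt]]] := ht z1 h1.
  have c1 := cvg_dotr (t3 z h) kt; have c2 := hq_cvg (w := z) (h' := h) hu.
  rewrite dot_conj -(rep_ip hs) [RHS]dot_conj; congr Num.conj.
  apply: (cvgn_lim_eq c1 c2) => n.
  by rewrite dot_conj (d1 _ _ _ _ _ (ru n)) -dot_conj (rep_ip hs).
have d2 a z h z' h' : M a ->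
    dot (t3 z' h') (p a (t3 z h)) = dot h' (s (ip z' (lact a z)) h).
  move=> Ma; have [u [kk [ru hu kt]]] := ht z h.
  have Maa := vn_adj Ma.
  have il w : ip z' (lact a w) = ip (lact (adj a) z') w.
    by rewrite (lact_adj Maa) adjK //; exact: vn_bounded.
  have c1 := cvg_dotr (t3 z' h') (bounded_cvg (rep_bounded hp Ma) kt).
  have c2 := hq_cvg (w := lact (adj a) z') (h' := h') hu.
  rewrite il; apply: (cvgn_lim_eq c1 c2) => n.
  rewrite dot_conj (d1 _ _ _ _ _ (rel_lact Ma (ru n))) -dot_conj (rep_ip hs).
  by rewrite il.
exists t3; split=> //.
- move=> a z h Ma.
  apply: (@dot_eq _ _ _ _ (dot h (s (ip (lact a z) (lact a z)) h))).
  + have Maa := vn_adj Ma.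
    rewrite (rep_dot hp) // -[p _ (p _ _)]/((p (adj a) \o p a) _) -(rep_comp hp Maa Ma).
    rewrite d2; last exact: vn_comp.
    by rewrite (lact_adj Ma) (lact_comp G Maa Ma).
  + by rewrite dot_conj d2 // -dot_conj (rep_ip hs).
  + by rewrite gt.
- move=> x y h.
  have r : rel (tau x y) h (V x (t2 y h)).
    by exists 1%N, (fun=> x), (fun=> y); rewrite !big_ord1.
  apply/esym; apply: (@dot_eq _ _ _ _ (dot h (s (ip (tau x y) (tau x y)) h))).
  + exact: rel_dot.
  + exact: d1.
  + exact: gt.
- move=> C h sC CV z; have [u [kk [ru hu kt]]] := ht z h.
  apply: (subspace_limit sC _ kt) => n; have [m [x [y [_ ->]]]] := ru n.
  by apply: (subspace_sum sC).
Qed.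

End TensorStep.

(** * The isometry from the Fock space tensor product into [K] *)

Section FockMap.
Variables (R : realType) (M : vnalg R) (E : wcorr M) (F : fock E).
Variables (H K : hilbert R) (s : vn_map M -> H -> H) (hs : normal_rep s).
Variables (p : vn_map M -> K -> K) (hp : normal_rep p).
Variables (V : E -> K -> K).
Hypothesis Vbd : forall x, bounded_op (V x).
Hypothesis Vlin : forall k, linear (V^~ k).
Hypothesis Vdot : forall x y k l, dot (V x k) (V y l) = dot k (p (ip x y) l).
Hypothesis Vlact : forall a x k, M a -> p a (V x k) = V (lact a x) k.
Variable J : H -> K.
Hypothesis Jdot : forall h k, dot (J h) (J k) = dot h k.
Hypothesis Jp : forall a h, M a -> p a (J h) = J (s a h).
Hypothesis VJ : forall x k h, dot (V x k) (J h) = 0.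

Definition wandering_spec n (t : pow F n -> H -> K) :=
  gram s t /\ forall a z h, M a -> p a (t z h) = t (lact a z) h.

(** The formula on [powS x y] alone would not reach a general element of the next power, as these
    span only a sigma-dense subspace; the clause on [C] covers it. *)
Definition step_spec n (t : pow F n -> H -> K) (t' : pow F n.+1 -> H -> K) :=
  (forall x y h, t' (powS x y) h = V x (t y h)) /\
  forall (C : set K) h, closed_subspace C -> (forall x y, C (V x (t y h))) ->
    forall z, C (t' z h).

Lemma wandering_base : exists t : pow F 0 -> H -> K, wandering_spec t /\
  forall a h, M a -> t (pow0 F a) h = p a (J h).
Proof.
have key a b h : M a -> M b -> pow0 F a = pow0 F b -> p a (J h) = p b (J h).
  move=> Ma Mb ab; pose d := (-1) *: b + a.
  have Md : M d by apply: vn_lin.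
  have d0 : pow0 F d = 0 by rewrite /d (pow0_linear F) // ab scaleN1r addNr.
  have : p d (J h) = 0.
    apply: dot_eq0; rewrite (rep_dot hp) // -[p _ (p _ _)]/((p (adj d) \o p d) _).
    rewrite -(rep_comp hp (vn_adj Md) Md) -(pow0_ip F) // d0.
    by rewrite ip0r (rep0 hp) dot0.
  rewrite /d (rep_linear hp) // !fctE scaleN1r addrC => /eqP.
  by rewrite subr_eq0 => /eqP.
have /choice[c hc] : forall z : pow F 0, exists a, M a /\ z = pow0 F a.
  by move=> z; have [a Ma ->] := pow0_surj z; exists a.
have Mc z : M (c z) by case: (hc z).
have pc z : pow0 F (c z) = z by case: (hc z).
exists (fun z h => p (c z) (J h)); split; last first.
  by move=> a h Ma; apply: key => //; rewrite pc.
split=> [x h y k|a z h Ma].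
  rewrite (rep_dot hp) // -[p _ (p _ _)]/((p (adj (c x)) \o p (c y)) _).
  have Mx := vn_adj (Mc x).
  rewrite -(rep_comp hp Mx (Mc y)) Jp; last exact: vn_comp.
  by rewrite Jdot -(pow0_ip F) // !pc.
rewrite -[p a (p _ _)]/((p a \o p (c z)) _) -(rep_comp hp Ma (Mc z)).
by apply: key => //; [exact: vn_comp|rewrite pc -(pow0_lact F) // pc].
Qed.

Lemma wandering_next n (t : pow F n -> H -> K) : wandering_spec t ->
  exists t' : pow F n.+1 -> H -> K, wandering_spec t' /\ step_spec t t'.
Proof.
move=> [gt lt].
have [t' [gt' lt' tE tC]] := tensor_step (powS_tensor F n) hs hp Vlin Vdot Vlact gt lt.
by exists t'.
Qed.

Lemma wandering_tower : exists t : forall n, pow F n -> H -> K,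
  [/\ forall n, wandering_spec (t n), forall n, step_spec (t n) (t n.+1) &
      forall a h, M a -> t 0%N (pow0 F a) h = p a (J h)].
Proof.
have [t0 [wt0 t0E]] := cid wandering_base.
(* The recursion carries the proof of [wandering_spec], on which the existence of the next map
   depends; [step_spec] is then read off the same choice. *)
pose step n (u : {t : pow F n -> H -> K | wandering_spec t}) :=
  let v := cid (wandering_next (svalP u)) in
  exist (fun t => wandering_spec t) (sval v) (proj1 (svalP v)).
pose T := nat_rect (fun n => {t : pow F n -> H -> K | wandering_spec t})
  (exist _ t0 wt0) step.
exists (fun n => sval (T n)); split=> [n|n|//]; first exact: svalP (T n).
exact: (proj2 (svalP (cid (wandering_next (svalP (T n)))))).
Qed.

Variable t : forall n, pow F n -> H -> K.
Arguments t : clear implicits.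
Hypothesis twd : forall n, wandering_spec (t n).
Hypothesis tstep : forall n, step_spec (t n) (t n.+1).
Hypothesis t0E : forall a h, M a -> t 0%N (pow0 F a) h = p a (J h).

Let gt n : gram s (t n). Proof. by case: (twd n). Qed.

(** [Vdot] removes one [V] from each side and lowers both degrees. When one degree reaches [0],
    moving [p a] to the other side leaves a range of [V] against [J], which is [VJ]. *)
Lemma tower_orth m n x h y k : m != n -> dot (t m x h) (t n y k) = 0.
Proof.
have V0 l z h' k' : dot (V l k') (t 0%N z h') = 0.
  have [a Ma ->] := pow0_surj z; rewrite t0E //.
  by rewrite -[a]vn_adjK // -(rep_dot hp) ?Vlact ?VJ //; exact: vn_adj.
have S0 m' x' y' h' k' : dot (t m'.+1 x' h') (t 0%N y' k') = 0.
  have [_ tC] := tstep m'.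
  by apply: (tC _ _ (orthl_subspace (t 0%N y' k'))) => z w; exact: V0.
elim: m n x h y k => [|m IH] [|n] x h y k //= mn.
  by rewrite dot_conj S0 rmorph0.
have [_ tC] := tstep m.
apply: (tC _ _ (orthl_subspace (t n.+1 y k))) => z w /=.
have [_ tC'] := tstep n.
apply: (tC' _ _ (orth_subspace (V z (t m w h)))) => z' w' /=.
have [_ la] := twd n.
by rewrite Vdot la ?IH //; exact: ip_in.
Qed.

Let psum (y : F) h N : K := \sum_(n < N) t n (Defs.coord n y) h.

Lemma fock_dot y h z k N : dot (psum y h N) (psum z k N) =
  \sum_(n < N) dot h (s (ip (Defs.coord n y) (Defs.coord n z)) k).
Proof.
rewrite dot_suml; apply: eq_bigr => i _; rewrite dot_sum (bigD1 i) //= gt.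
rewrite big1 ?addr0 // => j ji; apply: tower_orth.
by rewrite eq_sym.
Qed.

(** As [a |-> <h, s(a) h>] is in the predual, [coord_ip] makes the squared norms of the components
    summable; orthogonality of the degrees then makes the partial sums Cauchy. *)
Lemma fock_cvg y h : exists l : K, (fun N => psum y h N) @ \oo --> l.
Proof.
pose c n := hq s h (Defs.coord n y).
have c0 n : 0 <= c n by exact: hq_ge0.
pose S := hq s h y.
have hc n : dot h (s (ip (Defs.coord n y) (Defs.coord n y)) h) = (c n)%:C.
  by rewrite -/(hform s h _ _) (psd_qE (hform_psd hs h)).
have cS : series c @ \oo --> S.
  have h1 := coord_ip (x := y) (y := y) (rep_predual hs h h).
  apply/cvgrPdist_lt => e e0.
  move/cvg_nrmP : h1 => /(_ e e0); apply: filterS => n.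
  rewrite -/(hform s h y y) (psd_qE (hform_psd hs h)) -/(hq s h y) -/S.
  have -> : series (fun n => dot h (s (ip (Defs.coord n y) (Defs.coord n y)) h) : R[i]^o) n = (series c n)%:C.
    rewrite /series /= rmorph_sum; apply: eq_bigr => i _.
    by rewrite hc.
  by rewrite -rmorphB nrm_real distrC.
have cS1 n : series c n.+1 = series c n + c n by rewrite seriesSr.
have psumS N : psum y h N.+1 = psum y h N + t N (Defs.coord N y) h.
  by rewrite /psum big_ord_recr.
have cle n : series c n <= S.
  rewrite -(cvg_lim _ cS) //; apply: nondecreasing_cvgn_le; last exact: cvgP cS.
  apply: (homo_leq (f := series c) (@lexx _ R) (fun y x z => @le_trans _ R y x z)) => i.
  by rewrite cS1 lerDl.
have hps m k : dot (psum y h (m + k) - psum y h m) (psum y h (m + k) - psum y h m) =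
    (series c (m + k)%N - series c m)%:C.
  elim: k => [|k IH]; first by rewrite addn0 !subrr dot0.
  have o N : (N <= m + k)%N -> dot (psum y h N) (t (m + k)%N (Defs.coord (m + k) y) h) = 0.
    move=> Nm; rewrite dot_suml big1 // => i _; apply: tower_orth.
    by rewrite neq_ltn (leq_trans (ltn_ord i) Nm).
  rewrite addnS cS1 psumS.
  rewrite addrAC.
  set u := psum y h (m + k) - psum y h m in IH *; set v := t _ _ _.
  have uv : dot u v = 0 by rewrite dotBl !o ?leq_addr // subrr.
  clearbody u; rewrite dotDl !dotD IH uv [dot v u]dot_conj uv rmorph0 addr0 add0r gt hc.
  by rewrite -rmorphD addrAC.
apply: (@cauchy_nrm _ _ _ (fun n => Num.sqrt (S - series c n))).
  move=> m n mn; rewrite -(@ler_pXn2r _ 2) ?nnegrE ?nrm_ge0 ?sqrtr_ge0 //.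
  rewrite sqr_sqrtr ?subr_ge0 // -Re_dotxx -(subnKC mn) hps /=.
  by rewrite lerD2r.
have h0 : (fun n => S - series c n) @ \oo --> (0 : R).
  by rewrite -(subrr S); apply: cvgB => //; exact: cvg_cst.
have := @cvg_comp _ _ _ _ (@Num.sqrt R) _ _ _ h0 (@sqrt_continuous R 0).
by rewrite sqrtr0.
Qed.

Lemma fock_map : exists T : F -> H -> K, [/\ gram s T,
  forall a y h, M a -> p a (T y h) = T (lact a y) h,
  forall x y h, V x (T y h) = T (create x y) h,
  forall h, closure (tensor_span T) (J h) &
  forall x k, closure (tensor_span T) k -> closure (tensor_span T) (adj (V x) k)].
Proof.
have /choice[T0 hT0] : forall yh : F * H, exists l : K, (fun N => psum yh.1 yh.2 N) @ \oo --> l.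
  by move=> [y h]; exact: fock_cvg.
pose T y h := T0 (y, h).
have hT y h : (fun N => psum y h N) @ \oo --> T y h by exact: (hT0 (y, h)).
have gT : gram s T.
  move=> y h z k; apply: (cvgn_lim_eq (cvg_dot (hT y h) (hT z k)) (coord_ip (x := y) (y := z) (rep_predual hs h k))).
  by move=> n; rewrite fock_dot /series /= big_mkord.
have Tl a y h : M a -> p a (T y h) = T (lact a y) h.
  move=> Ma; apply: (cvgn_lim_eq (bounded_cvg (rep_bounded hp Ma) (hT y h)) (hT (lact a y) h)).
  move=> n; rewrite (lin_sum (rep_lin hp Ma)); apply: eq_bigr => i _.
  by have [_ ->//] := twd i; rewrite (coord_lact _ _ Ma).
have TV x y h : V x (T y h) = T (create x y) h.
  (* Creation raises degrees by one, so a partial sum of [n] terms is compared with one of [n + 1]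
     terms, whose degree [0] term vanishes. *)
  apply: (cvgn_lim_eq (bounded_cvg (Vbd x) (hT y h)) (cvgn_shift (hT (create x y) h))).
  move=> n; rewrite /psum big_ord_recl /= create0.
  have -> : t 0%N 0 h = 0 by have := lin0 (gram_linl hs (@gt 0%N) h).
  rewrite add0r (lin_sum (Vbd x).1); apply: eq_bigr => i _.
  by rewrite /bump add1n createS; have [-> _] := tstep i.
(* A sequence with one nonzero coordinate comes from the Fock space, so the range of [T] contains
   that of each [t n]. *)
have Temb n (z : pow F n) : exists y, forall h, T y h = t n z h.
  pose f : forall m, pow F m := dfwith (fun m => 0 : pow F m) n z.
  have fz m : m != n -> f m = 0 by move=> mn; rewrite /f dfwithout // eq_sym.
  have fn : f n = z by rewrite /f dfwithin.
  have [|y hy] := coord_surj (f := F) (s := f).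
    exists (opnorm (ip z z)) => N.
    have oz : 0 <= opnorm (ip z z) by apply/opnorm_ge0/vn_bounded/ip_in.
    have [nN|Nn] := ltnP n N.
      rewrite (bigD1 (Ordinal nN)) //= fn big1 ?addr0 // => i ni.
      by rewrite fz // ip0r.
    rewrite big1 => [|i _].
      by apply: opnorm_ub => // h; rewrite nrm0 mulr_ge0 ?nrm_ge0.
    by rewrite fz ?ip0r // neq_ltn (leq_trans (ltn_ord i) Nn).
  exists y => h.
  have h1 : (fun N => psum y h (N + n.+1)%N) @ \oo --> T y h.
    have := @cvg_shiftn n.+1 _ (fun N => psum y h N) (nbhs (T y h)).
    by move/propeqP => [_]; apply.
  have h2 : (fun N => t n z h) @ \oo --> t n z h by exact: cvg_cst.
  apply: (cvgn_lim_eq h1 h2) => N.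
  rewrite /psum (bigD1 (Ordinal (leq_addl N n.+1 : (n < N + n.+1)%N))) //= hy fn big1 ?addr0 //.
  move=> i ni; rewrite hy (fz _ ni).
  by have := lin0 (gram_linl hs (@gt i) h).
pose S := closure (tensor_span T).
have sS : closed_subspace S by exact: closure_span_subspace (gram_linl hs gT).
have ST y h : S (T y h) by apply: subset_closure; exact: tensor_span1.
have St n z h : S (t n z h) by have [y <-] := Temb n z.
(* [adj (V x)] kills degree [0], by [VJ], and sends [V x' (t n z')] to [t n (<x, x'> z')]. *)
have Vt x n z h : S (adj (V x) (t n z h)).
  case: n z => [|n] z.
    rewrite (_ : adj _ _ = 0); first by case: sS.
    apply: dot_inj => w; rewrite (adjPr (Vbd x)) dot0.
    have [a Ma ->] := pow0_surj z; rewrite t0E //.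
    by rewrite -[a]vn_adjK // -(rep_dot hp) ?Vlact ?VJ //; exact: vn_adj.
  have [_ tC] := tstep n.
  apply: (tC _ _ (preimage_subspace (bounded_adj (Vbd x)) sS)) => x' z' /=.
  rewrite (_ : adj _ _ = t n (lact (ip x x') z') h); first exact: St.
  apply: dot_inj => w; rewrite (adjPr (Vbd x)) Vdot.
  by have [_ ->//] := twd n; exact: ip_in.
exists T; split=> //.
  move=> h; have := St 0%N (pow0 F id) h; rewrite t0E ?(rep_id hp) //; exact: vn_id.
move=> x; have sV := preimage_subspace (bounded_adj (Vbd x)) sS.
apply: (closure_span_sub sV) => y h; apply: (subspace_limit sV _ (hT y h)) => N.
by apply: (subspace_sum sV) => i; exact: Vt.
Qed.

End FockMap.

(** * The wandering subspace of the dilation *)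

Section Isometry.
Variable R : realType.

Lemma isometry_linear (X K : hilbert R) (A : X -> K) :
  (forall x y, dot (A x) (A y) = dot x y) -> linear A.
Proof.
move=> iA a x y; apply: (@dot_eq _ _ _ _ (dot (a *: x + y) (a *: x + y))).
- by rewrite iA.
- by rewrite dotD dotZ !iA -dotZ -dotD.
- by rewrite dotDl dotZl !dotD !dotZ !iA -!dotZ -!dotD -dotZl -dotDl.
Qed.

Lemma isometry_nrm (X K : hilbert R) (A : X -> K) :
  (forall x y, dot (A x) (A y) = dot x y) -> forall x, nrm (A x) = nrm x.
Proof.
move=> iA x; apply/eqP; rewrite -(@eqrXn2 _ 2) ?nrm_ge0 //.
by rewrite -!Re_dotxx iA.
Qed.

Lemma isometry_bounded (X K : hilbert R) (A : X -> K) :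
  (forall x y, dot (A x) (A y) = dot x y) -> bounded_op A.
Proof.
move=> iA; split; first exact: isometry_linear.
by exists 1 => x; rewrite isometry_nrm // mul1r.
Qed.

Lemma isometry_extend (Y Z : lmodType R[i]) (X K : hilbert R)
    (t : Y -> Z -> X) (t' : Y -> Z -> K) :
  (forall z, linear (t^~ z)) -> (forall z, linear (t'^~ z)) ->
  (forall x h y k, dot (t x h) (t y k) = dot (t' x h) (t' y k)) ->
  closure (tensor_span t) = setT ->
  exists A : X -> K, (forall x y, dot (A x) (A y) = dot x y) /\
    forall y z, A (t y z) = t' y z.
Proof.
move=> tl tl' tt' dt.
pose rel x k := exists n (y : 'I_n -> Y) (z : 'I_n -> Z),
  x = \sum_i t (y i) (z i) /\ k = \sum_i t' (y i) (z i).
have rel_lin x1 k1 x2 k2 : rel x1 k1 -> rel x2 k2 -> rel (x1 - x2) (k1 - k2).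
  move=> [m [x [y [-> ->]]]] [n [x' [y' [-> ->]]]].
  exists (m + n)%N, (fun i : 'I_(m + n) => match fintype.split i with inl j => x j | inr j => - x' j end),
    (fun i : 'I_(m + n) => match fintype.split i with inl j => y j | inr j => y' j end).
  rewrite !big_split_ord /= -!sumrN; split; congr (_ + _); apply: eq_bigr => i _.
  - by rewrite (_ : fintype.split _ = inl i) //; exact: (unsplitK (inl i)).
  - rewrite (_ : fintype.split _ = inr i); last exact: (unsplitK (inr i)).
    by rewrite [RHS](linN (tl _)).
  - by rewrite (_ : fintype.split _ = inl i) //; exact: (unsplitK (inl i)).
  - rewrite (_ : fintype.split _ = inr i); last exact: (unsplitK (inr i)).
    by rewrite [RHS](linN (tl' _)).
have rel_dot x1 k1 x2 k2 : rel x1 k1 -> rel x2 k2 -> dot k1 k2 = dot x1 x2.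
  move=> [m [x [y [-> ->]]]] [n [x' [y' [-> ->]]]].
  rewrite !dot_suml; apply: eq_bigr => i _; rewrite !dot_sum; apply: eq_bigr => j _.
  by rewrite tt'.
pose approx (x : X) (k : K) := exists (u : nat -> X) (v : nat -> K),
  [/\ forall n, rel (u n) (v n), u @ \oo --> x & v @ \oo --> k].
have /choice[A hA] : forall x, exists k, approx x k.
  move=> x; have /closureP[u0 hu0 ux] : closure (tensor_span t) x by rewrite dt.
  have /choice[u hu] : forall n : nat, exists y, tensor_span t y /\ nrm (y - x) < n.+1%:R^-1.
    move=> n; have n0 : 0 < n.+1%:R^-1 :> R by rewrite invr_gt0 ltr0Sn.
    move/cvg_nrmP : ux => /(_ _ n0)[N _ /(_ N (leqnn N)) h].
    by exists (u0 N).
  have /choice[v hv] : forall n, exists k, rel (u n) k.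
    move=> n; have [[m [y [z E]]] _] := hu n.
    by exists (\sum_i t' (y i) (z i)), m, y, z.
  have [||k hk] := @cauchy_nrm _ _ v (fun n => 2 * n.+1%:R^-1).
  - move=> m n mn; have r := rel_lin _ _ _ _ (hv n) (hv m).
    have -> : nrm (v n - v m) = nrm (u n - u m).
      apply/eqP; rewrite -(@eqrXn2 _ 2) ?nrm_ge0 // -!Re_dotxx.
      by rewrite (rel_dot _ _ _ _ r r).
    apply: (le_trans (nrm_tri _ x _)); rewrite (nrmBC x).
    have h1 := ltW (proj2 (hu m)); have h2 := ltW (proj2 (hu n)).
    have : n.+1%:R^-1 <= m.+1%:R^-1 :> R by rewrite lef_pV2 ?posrE // ler_nat.
    move: h1 h2; set e1 := n.+1%:R^-1; set e2 := m.+1%:R^-1; move: e1 e2 => e1 e2 *; lra.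
  - by rewrite -(mulr0 2); apply: cvgMr; exact: cvg_harmonic.
  exists k, u, v; split=> //.
  apply: (@cvg_nrm_le _ _ _ _ (fun n => n.+1%:R^-1)); last exact: cvg_harmonic.
  by move=> n; apply: ltW; case: (hu n).
exists A.
have iA x y : dot (A x) (A y) = dot x y.
  have [u [v [ruv ux vx]]] := hA x; have [u' [v' [ruv' uy vy]]] := hA y.
  apply: (cvgn_lim_eq (cvg_dot vx vy) (cvg_dot ux uy)) => n.
  exact: rel_dot.
split=> // y z; have r : rel (t y z) (t' y z).
  by exists 1%N, (fun=> y), (fun=> z); rewrite !big_ord1.
have [u [v [ruv ux vx]]] := hA (t y z).
apply/esym; apply: (@dot_eq _ _ _ _ (dot (t y z) (t y z))).
- exact: rel_dot.
- apply: (cvgn_lim_eq (cvg_dotr (t' y z) vx) (cvg_dotr (t y z) ux)) => n.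
  exact: rel_dot.
- by rewrite iA.
Qed.

Lemma fixed_subspace (K : hilbert R) (A : K -> K) :
  bounded_op A -> closed_subspace [set k | A k = k].
Proof.
move=> bA; split=> [||a x y /= Cx Cy].
- apply: closed_seqP => u l Cu ul /=.
  exact: (cvgn_lim_eq (bounded_cvg bA ul) ul).
- exact: (lin0 bA.1).
- by rewrite bA.1 Cx Cy.
Qed.

End Isometry.

Section Wandering.
Variables (R : realType) (M : vnalg R) (E : wcorr M).
Variables (H : hilbert R) (s : vn_map M -> H -> H) (hs : normal_rep s).
Variables (T : E -> H -> H).
Variables (X : hilbert R) (t : E -> H -> X) (ht : is_hilbert_tensor s t).
Variables (Tt : X -> H) (bTt : bounded_op Tt).
Hypothesis TtE : forall x h, Tt (t x h) = T x h.
Hypothesis nTt : opnorm Tt < 1.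
Variables (K : hilbert R) (p : vn_map M -> K -> K) (hp : normal_rep p).
Variables (V : E -> K -> K).
Hypothesis Vbd : forall x, bounded_op (V x).
Hypothesis Vlin : forall k, linear (V^~ k).
Hypothesis Vdot : forall x y k l, dot (V x k) (V y l) = dot k (p (ip x y) l).
Hypothesis Vlact : forall a x k, M a -> p a (V x k) = V (lact a x) k.
Variables (W : H -> K).
Hypothesis iW : forall h k, dot (W h) (W k) = dot h k.
Hypothesis pW : forall a h, M a -> p a (W h) = W (s a h).
Hypothesis coW : forall x h, exists h', adj (V x) (W h) = W h'.
Hypothesis compW : forall x h, W (adj W (V x (W h))) = W (T x h).

Let bW : bounded_op W := isometry_bounded iW.

Let WK h : adj W (W h) = h.
Proof. by apply: dot_inj => k; rewrite adjPr. Qed.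

(** This is [Vtilde (I (x) W)]; [pW] is what makes inner products agree. *)
Lemma inflation_ex : exists A : X -> K, (forall x y, dot (A x) (A y) = dot x y) /\
    forall y z, A (t y z) = V y (W z).
Proof.
apply: isometry_extend.
- exact: (htensor_linearl ht).
- by move=> z; exact: Vlin.
- move=> x h y k; rewrite (htensor_dot ht) Vdot pW ?iW //; exact: ip_in.
- exact: (htensor_dense ht).
Qed.

Variable Theta : X -> K.
Hypothesis iTheta : forall x y, dot (Theta x) (Theta y) = dot x y.
Hypothesis ThetaE : forall y z, Theta (t y z) = V y (W z).

Let bTheta : bounded_op Theta := isometry_bounded iTheta.

Lemma Theta_in (C : set K) : closed_subspace C -> (forall x h, C (V x (W h))) ->
  forall x, C (Theta x).
Proof.
move=> sC CV x; have sT := closure_span_sub (preimage_subspace bTheta sC) (t := t).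
apply: sT; last by rewrite (htensor_dense ht).
by move=> y h /=; rewrite ThetaE.
Qed.

Definition defect h := W h - Theta (adj Tt h).

(** By coinvariance, and by [Vdot] with [pW] for the part through [Theta], [adj (V x) (defect h)]
    lies in the range of [W], say equal to [W z]. Its squared norm is [<V x (W z), defect h>], where
    both terms of the defect contribute [<T x z, h>] and cancel. *)
Lemma V_defect x k h : dot (V x k) (defect h) = 0.
Proof.
suff : adj (V x) (defect h) = 0.
  by move=> d0; rewrite -(adjPr (Vbd x)) d0 dot0.
have bP : bounded_op (W \o adj W) by apply: bounded_comp => //; exact: bounded_adj.
(* The range of [W], written as a fixed point set so that it is visibly closed. *)
have sP := fixed_subspace bP; set C := [set k | _] in sP.
have bVa := bounded_adj (Vbd x).
have C1 x' : C (adj (V x) (Theta x')).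
  apply: (Theta_in (preimage_subspace bVa sP)) => y h' /=.
  have -> : adj (V x) (V y (W h')) = W (s (ip x y) h').
    rewrite -pW; last exact: ip_in.
    by apply: dot_inj => l; rewrite (adjPr (Vbd x)) Vdot.
  by rewrite /C /= WK.
have C2 : C (adj (V x) (W h)) by have [h' ->] := coW x h; rewrite /C /= WK.
have C3 : C (adj (V x) (defect h)).
  rewrite (linB bVa.1) addrC -scaleN1r; case: sP => _ _; exact.
apply: dot_eq0; rewrite -{1}C3 /=; set z := adj W _.
rewrite (adjPr (Vbd x)) dotB -ThetaE iTheta (adjPr bTt) TtE ThetaE.
by rewrite -(adjP bW) -iW compW iW subrr.
Qed.

Lemma Theta_defect x h : dot (Theta x) (defect h) = 0.
Proof.
by apply: (Theta_in (orthl_subspace (defect h))) => y k /=; exact: V_defect.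
Qed.

(** [W h] is the orthogonal sum of [defect h] and [Theta (adj Tt h)]. *)
Lemma defect_dot h k : dot (defect h) (defect k) = dot h (k - Tt (adj Tt k)).
Proof.
have e1 : dot (W h) (defect k) = dot (defect h) (defect k).
  by rewrite [dot (defect h) _]dotBl Theta_defect subr0.
have e2 : dot (W h) (Theta (adj Tt k)) = dot (adj Tt h) (adj Tt k).
  rewrite -[W h](subrK (Theta (adj Tt h))) -/(defect h) dotDl iTheta.
  by rewrite [dot (defect h) _]dot_conj Theta_defect rmorph0 add0r.
by rewrite -e1 dotB iW e2 adjP // -dotB.
Qed.

(** The error [e] is orthogonal to all ranges of [V]. Its [W] terms cancel, which leaves a vector in
    the closed span of those ranges, so [<e, e> = 0]. *)
Lemma defect_rep a h : M a -> p a (defect h) = defect (s a h).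
Proof.
move=> Ma; have Maa := vn_adj Ma.
have e1 : p a (defect h) = W (s a h) - p a (Theta (adj Tt h)).
  by rewrite (linB (rep_lin hp Ma)) pW.
apply/eqP; rewrite -subr_eq0; apply/eqP; apply: dot_eq0.
set e := p a _ - _.
have eV x k : dot (V x k) e = 0.
  by rewrite dotB V_defect subr0 -[a]vn_adjK // -(rep_dot hp) // Vlact // V_defect.
have eV' x k : dot e (V x k) = 0 by rewrite dot_conj eV rmorph0.
have -> : dot e e = dot e (Theta (adj Tt (s a h)) - p a (Theta (adj Tt h))).
  by rewrite {2}/e e1 opprB addrC addrA subrK.
have sO := orth_subspace e.
rewrite dotB (Theta_in sO) ?sub0r; last by move=> x k; exact: eV'.
rewrite (Theta_in (preimage_subspace (rep_bounded hp Ma) sO)) ?oppr0 //.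
by move=> x k /=; rewrite Vlact // eV'.
Qed.

Let r := opnorm Tt.

Lemma adj_Tt_le h : nrm (adj Tt h) <= r * nrm h.
Proof. by apply: adj_le => //; [exact: opnorm_ge0|move=> x; exact: opnorm_le]. Qed.

Lemma wandering_isometry : exists J : H -> K,
  [/\ forall h k, dot (J h) (J k) = dot h k,
      forall a h, M a -> p a (J h) = J (s a h),
      forall x k h, dot (V x k) (J h) = 0 &
      forall h, exists h', defect h = J h'].
Proof.
pose c h := h - Tt (adj Tt h).
have cdot h k : dot h (c k) = dot (defect h) (defect k) by rewrite defect_dot.
have bc : bounded_op c.
  have -> : c = (-1) *: (Tt \o adj Tt) + id.
    by apply/funext => h; rewrite !fctE scaleN1r addrC.
  apply: bounded_lin; last exact: bounded_id.
  by apply: bounded_comp => //; exact: bounded_adj.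
have sc : selfadj c.
  by move=> h k; rewrite dot_conj cdot -dot_conj -cdot.
have r0 : 0 <= r by exact: opnorm_ge0.
have e0 : 0 < 1 - r ^+ 2 by rewrite subr_gt0 expr_lt1.
have ec h : (1 - r ^+ 2) * nrm h ^+ 2 <= complex.Re (dot h (c h)).
  rewrite dotB -(adjP bTt) cReB !Re_dotxx mulrBl mul1r lerD2l lerN2 -exprMn.
  by rewrite ler_pXn2r ?nnegrE ?mulr_ge0 ?nrm_ge0 // adj_Tt_le.
have [b [b' [[bb bb'] sb bE [b'E Eb'] hb]]] := sqrt_op bc sc e0 ec.
have bK h : b (b' h) = h by rewrite -[LHS]/((b \o b') h) b'E.
have b'K h : b' (b h) = h by rewrite -[LHS]/((b' \o b) h) Eb'.
exists (defect \o b'); split=> /=.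
- by move=> h k; rewrite -cdot -bE /= bK -sb bK.
- move=> a h Ma; rewrite defect_rep //.
  (* Commutation is read off the inner products of the defects, which [p] and [s] intertwine. *)
  have ac : s a \o c = c \o s a.
    apply/funext => k; apply: dot_inj => l /=; have Maa := vn_adj Ma.
    rewrite -[a in LHS]vn_adjK // -(rep_dot hs) // !cdot -!defect_rep //.
    by rewrite (rep_dot hp) // vn_adjK.
  have [_ ab'] := hb _ (rep_bounded hs Ma) ac.
  by rewrite -[s a (b' h)]/((s a \o b') h) ab'.
- by move=> x k h; exact: V_defect.
- by move=> h; exists (b h); rewrite b'K.
Qed.

End Wandering.

(** * Minimality *)

Section OrthogonalPart.
Variables (R : realType) (K : hilbert R) (S : set K) (sS : closed_subspace S).

Definition orth_part (Q : K -> K) :=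
  [/\ bounded_op Q, forall x, nrm (Q x) <= nrm x, forall x, Q x = 0 <-> S x &
      forall A B : K -> K, bounded_op A -> (forall x, S x -> S (A x)) ->
        (forall x, S x -> S (B x)) -> (forall x y, dot (B x) y = dot x (A y)) ->
        forall x, Q (A x) = A (Q x)].

(** [Q = 1 - P]. If [A] and its adjoint preserve [S], then [A] respects the decomposition of [x]
    into [P x] and [Q x], and uniqueness of the decomposition gives the commutation. *)
Lemma orth_part_ex : exists Q, orth_part Q.
Proof.
have [cS S0 lS] := sS.
have [P lP hP] := projection cS S0 lS.
have SP x : S (P x) by case: (hP x).
have oP x s : S s -> dot s (x - P x) = 0 by case: (hP x) => _ /[apply].
pose Q x := x - P x.
have uniq v s w : v = s + w -> S s -> (forall s', S s' -> dot s' w = 0) -> Q v = w.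
  move=> vE Ss ow; apply/eqP; rewrite -subr_eq0; apply/eqP/dot_eq0.
  have e : Q v - w = s - P v by rewrite /Q {1}vE addrAC addrK.
  have Se : S (s - P v) by rewrite addrC -scaleN1r; apply: lS.
  by rewrite {1}e dotB oP // ow // subrr.
have lQ : linear Q.
  by move=> a x y; rewrite /Q lP opprD addrACA -scalerBr.
have nQ x : nrm (Q x) <= nrm x.
  have [->|n0] := eqVneq (nrm (Q x)) 0; first exact: nrm_ge0.
  rewrite -(@ler_pM2r _ (nrm (Q x))); last by rewrite lt_def n0 nrm_ge0.
  rewrite -expr2 -Re_dotxx {1}/Q dotBl (oP x (P x)) // subr0.
  by rewrite (le_trans (ler_norm _)) // (le_trans (Re_le_nrm _)) // dot_CS.
have Q0 x : Q x = 0 <-> S x.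
  split=> [/eqP|Sx]; first by rewrite subr_eq0 => /eqP ->.
  by apply: (uniq _ x) => //; [rewrite addr0|move=> s _; rewrite dot0].
exists Q; split=> //.
  by split=> //; exists 1 => x; rewrite mul1r.
move=> A B bA SA SB BA x; apply: (uniq _ (A (P x))).
- by rewrite -(linD bA.1) addrC subrK.
- exact: SA.
- by move=> s Ss; rewrite -BA oP //; exact: SB.
Qed.

End OrthogonalPart.

Section Minimality.
Variables (R : realType) (M : vnalg R) (E : wcorr M).
Variables (H : hilbert R) (s : vn_map M -> H -> H) (hs : normal_rep s).
Variables (X : hilbert R) (t : E -> H -> X) (ht : is_hilbert_tensor s t).
Variables (Tt : X -> H) (bTt : bounded_op Tt) (nTt : opnorm Tt < 1).
Variables (K : hilbert R) (p : vn_map M -> K -> K) (hp : normal_rep p).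
Variables (V : E -> K -> K).
Hypothesis Vbd : forall x, bounded_op (V x).
Hypothesis Vdot : forall x y k l, dot (V x k) (V y l) = dot k (p (ip x y) l).
Variables (W : H -> K).
Hypothesis iW : forall h k, dot (W h) (W k) = dot h k.
Hypothesis pW : forall a h, M a -> p a (W h) = W (s a h).
Variable Theta : X -> K.
Hypothesis iTheta : forall x y, dot (Theta x) (Theta y) = dot x y.
Hypothesis ThetaE : forall y z, Theta (t y z) = V y (W z).
Variables (S : set K) (sS : closed_subspace S).
Hypothesis Sp : forall a k, M a -> S k -> S (p a k).
Hypothesis SV : forall x k, S k -> S (V x k).
Hypothesis SVa : forall x k, S k -> S (adj (V x) k).
Hypothesis Sdefect : forall h, S (W h - Theta (adj Tt h)).

Let bTheta : bounded_op Theta := isometry_bounded iTheta.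

(* The part of [W] orthogonal to [S] factors through [adj Tt], which is a strict
   contraction, so that its norm does not exceed a fraction of itself. *)
Lemma reducing_contains h : S (W h).
Proof.
have [Q [bQ nQ Q0 Qcomm]] := orth_part_ex sS.
have QV x k : Q (V x k) = V x (Q k).
  apply: (Qcomm (V x) (adj (V x))) => //; first exact: SV; first exact: SVa.
  by move=> y z; rewrite adjP.
have Qp a k : M a -> Q (p a k) = p a (Q k).
  move=> Ma; have Maa := vn_adj Ma.
  apply: (Qcomm (p a) (p (adj a))) => [|y|y|y z].
  - exact: (rep_bounded hp).
  - exact: Sp.
  - exact: Sp.
  - by rewrite (rep_dot hp) // vn_adjK.
pose A k := Q (W k).
have bA : bounded_op A by apply: bounded_comp => //; exact: isometry_bounded.
have AE k : A k = Q (Theta (adj Tt k)).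
  have := iffRL (Q0 _) (Sdefect k); rewrite (linB bQ.1) => /eqP.
  by rewrite subr_eq0 => /eqP.
have Ap a k : M a -> p a (A k) = A (s a k) by move=> Ma; rewrite -Qp // pW.
pose B := adj A \o A.
have bB : bounded_op B by apply: bounded_comp => //; exact: bounded_adj.
have Bdot k l : dot k (B l) = dot (A k) (A l) by rewrite /= adjPr.
have Bs a k : M a -> B (s a k) = s a (B k).
  move=> Ma; have Maa := vn_adj Ma; apply: dot_inj => l.
  rewrite Bdot -Ap // -[a in LHS]vn_adjK // -(rep_dot hp) // Ap // -Bdot.
  by rewrite (rep_dot hs) // vn_adjK.
(* [Q Theta] sends [xi (x) k] to [V xi (A k)]; this is the inequality between the norms of [I (x) A]
   and [A]. *)
have key (b : R) : 0 <= b -> (forall k, nrm (A k) ^+ 2 <= b * nrm k ^+ 2) ->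
    forall x, nrm (Q (Theta x)) ^+ 2 <= b * nrm x ^+ 2.
  move=> b0 hb.
  have fin n (xi : 'I_n -> E) (k : 'I_n -> H) (x := \sum_i t (xi i) (k i)) :
      nrm (Q (Theta x)) ^+ 2 <= b * nrm x ^+ 2.
    apply/ler_addgt0Pr => e e0.
    (* The slack [d] makes [b + d - adj A \o A] bounded below, so that it has a root; its size costs
       at most [e] in the end. *)
    pose d := e / (nrm x ^+ 2 + 1).
    have n0 : 0 < nrm x ^+ 2 + 1 by rewrite ltr_wpDl ?sqr_ge0.
    have d0 : 0 < d by rewrite divr_gt0.
    apply: (@le_trans _ _ ((b + d) * nrm x ^+ 2)); last first.
      by rewrite mulrDl lerD2l /d mulrAC ler_pdivrMr // ler_pM2l // lerDl.
    pose c := (b + d)%:C *: id - B.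
    have cN : Num.conj (b + d)%:C = (b + d)%:C.
      by apply: CrealP; rewrite complex_real.
    have bc : bounded_op c.
      have -> : c = (-1) *: B + (b + d)%:C *: id.
        by apply/funext => u; rewrite /c !fctE scaleN1r addrC.
      by apply: bounded_lin => //; apply: bounded_scale; exact: bounded_id.
    have cdot u v : dot u (c v) = (b + d)%:C * dot u v - dot (A u) (A v).
      by rewrite /c !fctE dotB dotZ Bdot.
    have sc : selfadj c.
      move=> u v; rewrite dot_conj !cdot rmorphB rmorphM /= cN.
      by rewrite -!(dot_conj, dot_conj (A u)).
    have ec u : d * nrm u ^+ 2 <= complex.Re (dot u (c u)).
      rewrite cdot cReB cReZ !Re_dotxx mulrDl addrAC lerDr subr_ge0.
      exact: hb.
    have [g [g' [[bg _] sg gE _ hg]]] := sqrt_op bc sc d0 ec.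
    have gs a u : M a -> g (s a u) = s a (g u).
      move=> Ma; have [|sag _] := hg _ (rep_bounded hs Ma).
        apply/funext => v; rewrite /= /c !fctE (linB (rep_lin hs Ma)).
        by rewrite (linZ (rep_lin hs Ma)) Bs.
      by rewrite -[LHS]/((g \o s a) u) -sag.
    have QE : Q (Theta x) = \sum_i V (xi i) (A (k i)).
      rewrite /x (lin_sum bTheta.1) (lin_sum bQ.1); apply: eq_bigr => i _.
      by rewrite ThetaE QV.
    have e1 : dot (Q (Theta x)) (Q (Theta x)) =
        \sum_i \sum_j dot (A (k i)) (A (s (ip (xi i) (xi j)) (k j))).
      rewrite QE dot_suml; apply: eq_bigr => i _; rewrite dot_sum.
      by apply: eq_bigr => j _; rewrite Vdot Ap //; exact: ip_in.
    have e2 : dot x x = \sum_i \sum_j dot (k i) (s (ip (xi i) (xi j)) (k j)).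
      rewrite dot_suml; apply: eq_bigr => i _; rewrite dot_sum.
      by apply: eq_bigr => j _; rewrite (htensor_dot ht).
    (* This is [(I (x) g) x]. As [g] commutes with [s M], its squared norm is
       [(b + d) |x|^2 - |Q (Theta x)|^2], and nonnegativity is the estimate. *)
    pose x' := \sum_i t (xi i) (g (k i)).
    have e3 : dot x' x' = (b + d)%:C * dot x x - dot (Q (Theta x)) (Q (Theta x)).
      rewrite e1 e2 mulr_sumr -sumrB dot_suml; apply: eq_bigr => i _.
      rewrite mulr_sumr -sumrB dot_sum; apply: eq_bigr => j _.
      rewrite (htensor_dot ht) -cdot -gE /= sg !gs //; exact: ip_in.
    have := sqr_ge0 (nrm x'); rewrite -(Re_dotxx x') e3 cReB cReZ !Re_dotxx.
    by rewrite subr_ge0.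
  move=> x; have /closureP[u hu ux] : closure (tensor_span t) x.
    by rewrite (htensor_dense ht).
  have bQT : bounded_op (Q \o Theta) by exact: bounded_comp.
  have h1 := cvg_nrm (bounded_cvg bQT ux); have h2 := cvg_nrm ux.
  have h3 : (fun n => nrm (Q (Theta (u n))) ^+ 2 - b * nrm (u n) ^+ 2) @ \oo -->
      nrm (Q (Theta x)) ^+ 2 - b * nrm x ^+ 2.
    apply: cvgB; first exact: (cvgM h1 h1).
    by apply: cvgMr; exact: (cvgM h2 h2).
  rewrite -subr_le0; apply: (cvgn_le_cst h3) => n.
  by rewrite subr_le0; have [m [xi [k ->]]] := hu n.
pose r := opnorm Tt.
have r0 : 0 <= r by exact: opnorm_ge0.
(* Starting from [|A| <= 1], each use of [A = Q Theta (adj Tt)] gains a factor [r^2], and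
   [r < 1]. *)
have iter n k : nrm (A k) ^+ 2 <= (r ^+ 2) ^+ n * nrm k ^+ 2.
  elim: n k => [|n IH] k.
    rewrite expr0 mul1r ler_pXn2r ?nnegrE ?nrm_ge0 //.
    by rewrite (le_trans (nQ _)) // isometry_nrm.
  have rn0 : 0 <= (r ^+ 2) ^+ n by rewrite !exprn_ge0.
  rewrite AE (le_trans (key _ rn0 IH _)) // [X in _ <= X * _]exprSr -mulrA ler_wpM2l //.
  rewrite -exprMn ler_pXn2r ?nnegrE ?mulr_ge0 ?nrm_ge0 //.
  by apply: adj_le => // y; exact: opnorm_le.
apply/Q0; apply: nrm_eq0; apply/eqP; rewrite -sqrf_eq0 eq_le sqr_ge0 andbT.
have h0 : (fun n => nrm (A h) ^+ 2 - (r ^+ 2) ^+ n * nrm h ^+ 2) @ \oo -->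
    nrm (A h) ^+ 2 - 0 * nrm h ^+ 2.
  apply: cvgB; first exact: cvg_cst.
  apply: cvgMl; apply: cvg_expr; rewrite ger0_norm ?sqr_ge0 //.
  by rewrite expr_lt1.
have := cvgn_le_cst h0 (c := 0); rewrite mul0r subr0; apply=> n.
by rewrite subr_le0 iter.
Qed.

End Minimality.

(** * The dilation as an induced representation *)

Theorem theorem2p13 (R : realType) (M : vnalg R) (E : wcorr M) (F : fock E)
    (H : hilbert R) (T : E -> H -> H) (sigma : vn_map M -> H -> H)
    (hT : cc_cov_rep T sigma)
    (X : hilbert R) (t : E -> H -> X) (ht : is_hilbert_tensor sigma t)
    (Ttilde : X -> H) (hTb : bounded_op Ttilde)
    (hTt : forall xi h, Ttilde (t xi h) = T xi h)
    (hnorm : opnorm Ttilde < 1)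
    (K : hilbert R) (V : E -> K -> K) (pi : vn_map M -> K -> K) (W : H -> K)
    (hV : minimal_isometric_dilation T sigma V pi W) :
  is_induced F V pi.
Proof.
have hs := cov_normal hT.
case: hV => [[cV iV] lW iW _ pW coW compW minW].
have hp := cov_normal cV; have Vbd := cov_bounded cV.
have Vlin k : linear (V^~ k).
  by move=> a x y; rewrite (cov_linear cV).
have Vdot x y k l : dot (V x k) (V y l) = dot k (pi (ip x y) l).
  by rewrite -iV /= adjPr.
have Vlact a x k : M a -> pi a (V x k) = V (lact a x) k.
  move=> Ma; have := cov_bimod cV x Ma (vn_id M).
  by rewrite ract_id (rep_id hp) => ->.
have pW' a h : M a -> pi a (W h) = W (sigma a h).
  by move=> /pW/(congr1 (fun f => f h)).
have compW' x h : W (adj W (V x (W h))) = W (T x h).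
  by have := congr1 (fun f => f h) (compW x).
have [theta [itheta thetaE]] := inflation_ex ht Vlin Vdot iW pW'.
have [J [Jdot Jp VJ JE]] := wandering_isometry hs ht hTb hTt hnorm hp Vbd Vdot Vlact
  iW pW' coW compW' itheta thetaE.
have [tn [twd tstep t0E]] := wandering_tower F hs hp Vlin Vdot Vlact Jdot Jp.
have [f [gf fp fV fJ fVa]] := fock_map hs hp Vbd Vdot Vlact VJ twd tstep t0E.
pose S := closure (tensor_span f).
have fl := gram_linl hs gf.
have sS : closed_subspace S by exact: closure_span_subspace.
have Sf y h : S (f y h) by apply: subset_closure; exact: tensor_span1.
have SV x k : S k -> S (V x k).
  apply: (closure_span_sub (preimage_subspace (Vbd x) sS)) => y h /=.
  by rewrite fV.
have Sp a k : M a -> S k -> S (pi a k).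
  move=> Ma; apply: (closure_span_sub (preimage_subspace (rep_bounded hp Ma) sS)) => y h /=.
  by rewrite fp.
have SW h : S (W h).
  apply: (reducing_contains hs ht hTb hnorm hp Vbd Vdot iW pW' itheta thetaE sS Sp SV fVa).
  by move=> k; rewrite -/(defect _ _ _ k); have [h' ->] := JE k; exact: fJ.
have dS : S = setT.
  case: (sS) => cS _ lS; exact: minW.
(* With the vectors [f y h] as elementary tensors, [K] is itself [F(E) (x)_sigma H], so the unitary
   is the identity. *)
exists H, sigma, K, f, V, pi, id; split; split=> //.
- by split=> //; exact: (gram_linr hs gf).
- by move=> a Ma; exact: (rep_bounded hp Ma).
- by move=> k; exists k.
Qed.
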